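(* Let $X$ be a topological space, $f:X\to\mathbb R$ a Morse-type function with Reeb graph $\mathrm R_f(X)$ and induced map $\tilde f:\mathrm R_f(X)\to\mathbb R$, and let $\mathcal I$ be a gomic of $\mathrm{im}(f)$ whose granularity is at most $\varepsilon$. Then $$\mathrm{Dg}(\tilde f)\setminus\{(x,y): |y-x|\le\varepsilon\}\ \subseteq\ \mathrm{Dg}(\overline{\mathrm M}_f(X,\mathcal I))\ \subseteq\ \mathrm{Dg}(\tilde f).$$ Thus, the features (branches, holes) of the Reeb graph that are missing in the MultiNerve Mapper (i.e. the points of $\mathrm{Dg}(\tilde f)$ not in $\mathrm{Dg}(\overline{\mathrm M}_f(X,\mathcal I))$) have spans $|y-x|$ at most $\varepsilon$. In particular, $d_b(\mathrm{Dg}(\overline{\mathrm M}_f(X,\mathcal I)),\mathrm{Dg}(\tilde f))\le\varepsilon/2$. Moreover, the two signatures $\mathrm{Dg}(\overline{\mathrm M}_f(X,\mathcal I))$ and $\mathrm{Dg}(\tilde f)$ are equal when $\varepsilon$ is smaller than the smallest vertical distance $|y-x|$ of the points $(x,y)$ of $\mathrm{Dg}(\tilde f)$ to the diagonal. Finally, $\overline{\mathrm M}_f(X,\mathcal I)$ and $\mathrm R_f(X)$ are isomorphic as combinatorial graphs up to one-step vertex splits and edge subdivisions when $\varepsilon$ is smaller than the smallest absolute difference between distinct critical values of $f$.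
   Context: Homology is singular with coefficients in $\mathbb Z/2$; ''connected'' means path-connected. Morse type: a continuous $f:X\to\mathbb R$ is of Morse type if (i) there is a finite set $\mathrm{Crit}(f)=\{a_1<\dots<a_n\}$ such that, with $a_0=-\infty,a_{n+1}=+\infty$, for every $i=0,\dots,n$ there are a compact locally connected space $Y_i$ and a homeomorphism $\mu_i:Y_i\times(a_i,a_{i+1})\to f^{-1}((a_i,a_{i+1}))$ with $f\circ\mu_i$ equal to the projection onto the second factor; (ii) each $\mu_i$ extends to a continuous map $\bar\mu_i:Y_i\times([a_i,a_{i+1}]\cap\mathbb R)\to f^{-1}([a_i,a_{i+1}]\cap\mathbb R)$; (iii) every level set of $f$ has finitely generated homology. Extended persistence diagram: let $\mathbb R^{op}=\{\tilde x:x\in\mathbb R\}$ with reversed order and $\mathbb R_{Ext}=\mathbb R\cup\{+\infty\}\cup\mathbb R^{op}$, ordered by $\alpha<+\infty<\tilde\beta$. Put $F_\alpha=f^{-1}((-\infty,\alpha])$, $F_{+\infty}=X$, $F_{\tilde\alpha}=(X,f^{-1}([\alpha,+\infty)))$. Applying $H_*$ gives the extended persistence module, which for Morse-type functions is a finite direct sum of interval modules $\mathbb I[b,d)$. $\mathrm{Dg}(f)$ is the multiset of points $(b,d)$, where elements of $\mathbb R^{op}$ are plotted as the corresponding reals. Points with both coordinates in $\mathbb R$ are ordinary ($\mathrm{Ord}$), both in $\mathbb R^{op}$ relative ($\mathrm{Rel}$), abscissa in $\mathbb R$ and ordinate in $\mathbb R^{op}$ extended ($\mathrm{Ext}$). Bottleneck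 distance: a partial matching $\Gamma\subseteq D\times D'$ between diagrams uses each point at most once and matches only points of the same type (ordinary, relative, extended) and same homological dimension; its cost is the maximum of $\|p-p'\|_\infty$ over matched pairs and of the $\ell^\infty$-distance to the diagonal $\Delta$ over unmatched points; $d_b(D,D')$ is the infimum of costs. Reeb graph: $x\sim_f y$ iff $f(x)=f(y)$ and $x,y$ lie in the same connected component of $f^{-1}(f(x))$; $\mathrm R_f(X)=X/\sim_f$, and $\tilde f$ satisfies $f=\tilde f\circ\pi$ with $\pi$ the quotient map. As a combinatorial multigraph its nodes are the connected components of the critical level sets. Gomic: a cover $\mathcal I$ of $Z\subseteq\mathbb R$ by open intervals of $Z$ (sets $J\cap Z$, $J$ an open interval of $\mathbb R$) that is minimal (no element is contained in the union of the others) and generic (no connected component of a proper subset $\tilde I=I\setminus\bigcup_{I'\ne I}I'$ is a singleton). Then $\tilde I$ is an interval (the proper subinterval of $I$), at most two elements intersect at a time, elements are totally ordered, and $I=I_\cap^-\sqcup\tilde I\sqcup I_\cap^+$, where $I_\cap^-$ (resp. $I_\cap^+$) is the intersection of $I$ with the element right below (resp. above) it, empty if there is none. The granularity is $\sup_{I\in\mathcal I}(\sup I-\inf I)$. MultiNerve Mapper $\overline{\mathrm M}_f(X,\mathcal I)$: the multigraph with one vertex per connected component of each $f^{-1}(I)$, $I\in\mathcal I$, and one edge per connected component of each $f^{-1}(I\cap J)$ ($I\ne J$ in $\mathcal I$), joining the components of $f^{-1}(I)$ and $f^{-1}(J)$ containing it. Its signature: for an interval $I$ with endpoints $a\le b$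 let $Q_I^+=\{a\le x\le y\le b\}$, $Q_I^-=\{a\le y<x\le b\}$, and $Q_O^{\mathcal I}=\bigcup_I Q^+_{\tilde I\cup I_\cap^+}$, $Q_R^{\mathcal I}=\bigcup_I Q^-_{\tilde I\cup I_\cap^-}$, $Q_{E^-}^{\mathcal I}=\bigcup_I Q_I^-$. Then $\mathrm{Dg}(\overline{\mathrm M}_f(X,\mathcal I))=(\mathrm{Ord}(\tilde f)\setminus Q_O^{\mathcal I})\cup(\mathrm{Ext}(\tilde f)\setminus Q_{E^-}^{\mathcal I})\cup(\mathrm{Rel}(\tilde f)\setminus Q_R^{\mathcal I})$. ''Up to one-step vertex splits and edge subdivisions'' means that $\overline{\mathrm M}_f(X,\mathcal I)$ is obtained from the combinatorial Reeb graph by splitting some vertices into two (replacing a vertex by two vertices joined by a single edge, one inheriting the edges going down from the vertex, the other the edges going up) and by subdividing some edges once.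
   Formalization: For the final graph-isomorphism claim only, X is assumed Hausdorff and im(f) bounded, and an edge may be subdivided any finite number of times rather than once; without these changes the claim is false. *)

(* Defs.v *)
From HB Require Import structures.
From mathcomp Require Import all_boot all_order all_algebra generic_quotient.
From mathcomp Require Import finmap multiset freeg.
From mathcomp Require Import all_classical all_reals.
From mathcomp Require Import ereal topology normedtype lra.

Set Implicit Arguments.
Unset Strict Implicit.
Unset Printing Implicit Defensive.

Import Order.TTheory GRing.Theory Num.Theory.
Import numFieldNormedType.Exports.

Local Open Scope classical_set_scope.
Local Open Scope ring_scope.

Lemma within_comp (U V W : topologicalType) (A : set U) (B : set V)
    (h : U -> V) (g : V -> W) :
  {within A, continuous h} -> {within B, continuous g} -> h @` A `<=` B ->
  {within A, continuous (g \o h)}.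
Proof.
move=> /subspace_sigL_continuousP ch /subspace_sigL_continuousP cg hAB.
apply/subspace_sigL_continuousP.
have hB (a : A) : h (set_val a) \in B by apply/mem_set/hAB/imageP/set_valP.
pose k (a : A) : B := exist _ (h (set_val a)) (hB a).
have ck : continuous k by apply: continuous_comp_initial.
move=> a; exact: (continuous_comp (ck a) (cg (k a))).
Qed.

Section paths.
Variables (R : realType) (T : topologicalType).
Implicit Types (A C : set T).

(* Components are path components throughout: [joined A x y] says that
   x and y are joined by a path lying in A. *)
Definition joined A (x y : T) := exists g : R -> T,
  [/\ {within `[0, 1], continuous g}, g 0 = x, g 1 = y &
      forall t, 0 <= t <= 1 -> A (g t)].

Definition path_component A C :=
  exists2 x, A x & C = [set y | joined A x y].

Lemma joined_refl A x : A x -> joined A x x.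
Proof.
by move=> Ax; exists (cst x); split => //; apply: continuous_subspaceT => t;
  exact: cst_continuous.
Qed.

Lemma joined_sym A x y : joined A x y -> joined A y x.
Proof.
move=> [g [cg g0 g1 gA]]; exists (g \o (fun t => 1 - t)); split => /=.
- apply: within_comp cg _.
    apply: continuous_subspaceT => t.
    by apply: continuousB; [exact: cst_continuous|exact: cvg_id].
  by move=> _ [t /= + <-]; rewrite !in_itv /= => ?; lra.
- by rewrite subr0.
- by rewrite subrr.
- by move=> t t01; apply: gA; lra.
Qed.

Lemma joined_trans A x y z : joined A x y -> joined A y z -> joined A x z.
Proof.
move=> [g [cg g0 g1 gA]] [h [ch h0 h1 hA]].
have lin (c d : R) (S : set R) : {within S, continuous (fun t => c * t - d)}.
  apply: continuous_subspaceT => t.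
  apply: continuousB; last exact: cst_continuous.
  by apply: continuousM; [exact: cst_continuous|exact: cvg_id].
pose k t := if t <= 2^-1 then g (2 * t - 0) else h (2 * t - 1).
exists k; split.
- have -> : `[0, 1]%classic = `[0, 2^-1] `|` `[2^-1, 1] :> set R.
    by apply/seteqP; split => t /=; rewrite !in_itv /=;
      [case: (lerP t 2^-1) => ? ?; [left|right]; lra | case=> ?; lra].
  apply: withinU_continuous; [exact: itv_closed|exact: itv_closed| |].
  + apply: (@subspace_eq_continuous _ _ _ (g \o (fun t => 2 * t - 0))).
      by move=> t; rewrite inE /= in_itv /= /k /from_subspace => /andP[_ ->].
    apply: within_comp cg _; first exact: lin.
    by move=> _ [t /= + <-]; rewrite !in_itv /= => ?; lra.
  + apply: (@subspace_eq_continuous _ _ _ (h \o (fun t => 2 * t - 1))).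
      move=> t; rewrite inE /= in_itv /= /k /from_subspace => /andP[t2 _].
      case: ifPn => // t2'; have -> : t = 2^-1 by lra.
      by rewrite divff // subrr subr0 h0 g1.
    apply: within_comp ch _; first exact: lin.
    by move=> _ [t /= + <-]; rewrite !in_itv /= => ?; lra.
- by rewrite /k invr_ge0 ler0n mulr0 subr0.
- rewrite /k; case: ifPn => [|_]; first by rewrite leNgt invf_lt1 ?ltr1n ?ltr0n.
  by have -> : 2 * 1 - 1 = 1 :> R by lra.
- move=> t t01; rewrite /k; case: ifPn => ?; [apply: gA|apply: hA]; lra.
Qed.
End paths.

Section simplices.
Variable R : realType.

Definition std_simplex n : set 'rV[R]_n.+1 :=
  [set t | (forall i, 0 <= t ord0 i) /\ \sum_i t ord0 i = 1].

Arguments std_simplex : clear implicits.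

Definition coface_mx n (i : 'I_n.+2) (t : 'rV[R]_n.+1) : 'rV[R]_n.+2 :=
  \row_j (if unlift i j is Some k then t ord0 k else 0).

Lemma coface_subproof n (i : 'I_n.+2) (t : std_simplex n) :
  coface_mx i (set_val t) \in std_simplex n.+1.
Proof.
have [t0 t1] := set_valP t; apply/mem_set; split=> [j|].
  by rewrite mxE; case: unliftP => [k _|_] //; exact: t0.
rewrite (bigD1_ord i) //= mxE unlift_none add0r -[RHS]t1.
by apply: eq_bigr => k _; rewrite mxE liftK.
Qed.

Definition coface n (i : 'I_n.+2) (t : std_simplex n) : std_simplex n.+1 :=
  exist _ (coface_mx i (set_val t)) (coface_subproof i t).

Lemma coface_continuous n (i : 'I_n.+2) : continuous (coface i).
Proof.
apply: continuous_comp_initial => t A [P tP PA].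
suff : \forall s \near t, forall a b, P a b (coface_mx i (set_val s) a b).
  by apply: filterS => s Ps; apply: PA.
have FF : Filter (nbhs t) by exact: nbhs_filter.
apply: (@filter_forall _ _ (fun a s =>
  forall b, P a b (coface_mx i (set_val s) a b)) _ FF) => a.
apply: (@filter_forall _ _ (fun b s =>
  P a b (coface_mx i (set_val s) a b)) _ FF) => b.
have := tP a b; rewrite /= mxE; case E : (unlift i b) => [k|] Pab; last first.
  apply: nearW => s; rewrite mxE E; exact: nbhs_singleton Pab.
have ct : {for t, continuous (fun s : std_simplex n => set_val s ord0 k)}.
  have cv := @initial_continuous (std_simplex n) _ set_val t.
  exact: (continuous_comp cv (@coord_continuous R 1 n.+1 ord0 k (set_val t))).
apply: (@filterS _ _ FF _ _ _ (ct _ Pab)) => s /=.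
by rewrite mxE E.
Qed.

HB.instance Definition _ n (i : 'I_n.+2) :=
  isContinuous.Build _ _ (coface i) (@coface_continuous n i).

End simplices.
Arguments std_simplex R n : clear implicits.

Section homology.
Variables (R : realType) (T : topologicalType).
Implicit Types A B : set T.

Definition singular n := continuousType (std_simplex R n) T.
HB.instance Definition _ n := Choice.on (singular n).

Definition chain n := {freeg (singular n) / 'F_2}.
HB.instance Definition _ n := GRing.Lmodule.on (chain n).

Definition face n (i : 'I_n.+2) (s : singular n.+1) : singular n :=
  s \o coface i.

(* No alternating signs: the coefficients are in Z/2. *)
Definition boundary n : chain n.+1 -> chain n :=
  fglift (fun s : singular n.+1 => \sum_(i < n.+2) << face i s >> : chain n).

(* The chains of a subspace A are those whose simplices have image in A. *)
Definition chain_in n A (c : chain n) :=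
  forall s : singular n, coeff s c != 0 -> forall t, A (s t).

(* For B `<=` A, H_n(A, B) is the quotient of the subspace
   [rel_cycle n A B] of [chain n] by its subspace [rel_bound n A B]. *)
Definition rel_cycle n A B : chain n -> Prop :=
  match n with
  | 0%N => fun c => chain_in A c
  | m.+1 => fun c : chain m.+1 => chain_in A c /\ chain_in B (boundary c)
  end.

Definition rel_bound n A B (c : chain n) := exists (d : chain n.+1) (b : chain n),
  [/\ chain_in A d, chain_in B b & c = boundary d + b].

Definition fg_homology n A := exists m (g : 'I_m -> chain n),
  (forall i, rel_cycle A set0 (g i)) /\
  forall c, rel_cycle A set0 c -> exists a : 'I_m -> 'F_2,
    rel_bound A set0 (c - \sum_i a i *: g i).

End homology.

Section morse.
Variable R : realType.

Definition homeo_on (U V : topologicalType) (A : set U) (B : set V)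
    (h : U -> V) :=
  [/\ set_bij A B h, {within A, continuous h} &
      forall W, open W -> exists2 W', open W' & h @` (A `&` W) = B `&` W'].

(* Connectedness here is the usual one: it is implied by the path version, so
   Morse-type functions are not restricted by this choice. *)
Definition locally_connected (Y : topologicalType) :=
  forall (y : Y) U, nbhs y U ->
  exists V, [/\ nbhs y V, connected V & V `<=` U].

Variables (X : topologicalType) (f : X -> R).

Definition oslab (a b : \bar R) : set R := [set t | (a < t%:E < b)%E].
Definition cslab (a b : \bar R) : set R := [set t | (a <= t%:E <= b)%E].

(* [mu] is the extended map; its restriction to the open slab is the
   homeomorphism, and its values outside the closed slab are irrelevant. *)
Definition product_over (a b : \bar R) :=
  exists (Y : topologicalType) (mu : Y * R -> X),
  [/\ compact [set: Y] /\ locally_connected Y,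
      homeo_on ([set: Y] `*` oslab a b) (f @^-1` oslab a b) mu,
      forall y t, oslab a b t -> f (mu (y, t)) = t,
      {within [set: Y] `*` cslab a b, continuous mu} &
      mu @` ([set: Y] `*` cslab a b) `<=` f @^-1` cslab a b].

Definition slab_ends (crit : seq R) : seq (\bar R) :=
  -oo%E :: rcons (map EFin crit) +oo%E.

Definition morse_type (crit : seq R) :=
  [/\ continuous f,
      sorted <%R crit,
      forall i, (i <= size crit)%N ->
        product_over (slab_ends crit)`_i (slab_ends crit)`_i.+1 &
      forall t n, fg_homology R n (f @^-1` [set t])].

End morse.

Section reeb.
Variables (R : realType) (X : topologicalType) (f : X -> R).

Definition reeb_rel : rel X :=
  fun x y => `[< f x = f y /\ joined R (f @^-1` [set f x]) x y >].

Lemma reeb_rel_refl : reflexive reeb_rel.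
Proof. by move=> x; apply/asboolP; split=> //; exact: joined_refl. Qed.

Lemma reeb_rel_sym : symmetric reeb_rel.
Proof.
have sub x y : reeb_rel x y -> reeb_rel y x.
  move=> /asboolP[fxy xy]; apply/asboolP; split=> //.
  by rewrite -fxy; exact: joined_sym.
by move=> x y; apply/idP/idP; exact: sub.
Qed.

Lemma reeb_rel_trans : transitive reeb_rel.
Proof.
move=> y x z /asboolP[fxy xy] /asboolP[fyz yz]; apply/asboolP; split.
  by rewrite fxy.
by apply: joined_trans xy _; rewrite fxy.
Qed.

Canonical reeb_equiv :=
  EquivRel reeb_rel reeb_rel_refl reeb_rel_sym reeb_rel_trans.

Definition reeb_graph : topologicalType :=
  quotient_topology {eq_quot reeb_equiv}%qT.

Definition reeb_map (q : reeb_graph) : R := f (repr q).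

Lemma reeb_mapE x : reeb_map (\pi_reeb_graph%qT x) = f x.
Proof.
rewrite /reeb_map; case: piP => y /eqquotP /asboolP[-> _] //.
Qed.

End reeb.
Arguments reeb_graph {R X} f.
Arguments reeb_map {R X} f q.

Inductive ptype := Ord | Rel | Ext.

Definition ptype_code (t : ptype) : 'I_3 :=
  match t with Ord => inord 0 | Rel => inord 1 | Ext => inord 2 end.
Definition ptype_decode (i : 'I_3) : ptype :=
  match val i with 0%N => Ord | 1%N => Rel | _ => Ext end.
Lemma ptype_codeK : cancel ptype_code ptype_decode.
Proof. by case; rewrite /ptype_decode /= inordK. Qed.
HB.instance Definition _ := Choice.copy ptype (can_type ptype_codeK).

Section persistence.
Variable R : realType.

(* [XOp x] is the element of R^op corresponding to x. *)
Inductive xreal := XFin of R | XInf | XOp of R.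

Definition xlt (u v : xreal) : bool :=
  match u, v with
  | XFin a, XFin b => a < b
  | XFin _, _ => true
  | XInf, XOp _ => true
  | XOp a, XOp b => b < a
  | _, _ => false
  end.

Definition xle (u v : xreal) : bool :=
  match u, v with
  | XFin a, XFin b => a <= b
  | XFin _, _ => true
  | XInf, XFin _ => false
  | XInf, _ => true
  | XOp a, XOp b => b <= a
  | XOp _, _ => false
  end.

(* A point of a diagram: homological dimension, type and plane coordinates. *)
Definition dpoint : choiceType := (nat * ptype * (R * R))%type.
Local Notation dgm := {mset dpoint}%mset.

Definition pdim (p : dpoint) : nat := p.1.1.
Definition ptyp (p : dpoint) : ptype := p.1.2.
Definition pxy (p : dpoint) : R * R := p.2.
Definition pspan (p : dpoint) : R := `|(pxy p).2 - (pxy p).1|.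

Definition birth (p : dpoint) : xreal :=
  if ptyp p is Rel then XOp (pxy p).1 else XFin (pxy p).1.
Definition death (p : dpoint) : xreal :=
  if ptyp p is Ord then XFin (pxy p).2 else XOp (pxy p).2.
Definition alive (p : dpoint) (u : xreal) : bool :=
  xle (birth p) u && xlt u (death p).

Variables (X : topologicalType) (f : X -> R).

Definition filt_space (u : xreal) : set X :=
  if u is XFin a then f @^-1` [set t | t <= a] else setT.
Definition filt_sub (u : xreal) : set X :=
  if u is XOp a then f @^-1` [set t | a <= t] else set0.

(* The n-th extended persistence module of f is isomorphic to the direct sum of
   the interval modules I[birth p, death p) for p in s. The isomorphism at index
   u is [phi u], given on cycles and with kernel the boundaries; its naturality
   is expressed by the last clause, since the structure maps of the left-hand
   side are induced by inclusions of chains, and those of I[b, d) are the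
   identity between indices of [b, d), and zero elsewhere. *)
Definition interval_decomposition (n : nat) (s : seq dpoint) :=
  exists phi : xreal -> chain R X n -> 'rV['F_2]_(size s),
  let Z u := @rel_cycle R X n (filt_space u) (filt_sub u) in
  let B u := @rel_bound R X n (filt_space u) (filt_sub u) in
  let live u (k : 'I_(size s)) := alive (tnth (in_tuple s) k) u in
  [/\ forall u c d, Z u c -> Z u d -> phi u (c + d) = phi u c + phi u d,
      forall u c, Z u c -> (phi u c = 0 <-> B u c),
      forall u c k, Z u c -> ~~ live u k -> phi u c ord0 k = 0,
      forall u (w : 'rV_(size s)), (forall k, ~~ live u k -> w ord0 k = 0) ->
        exists2 c, Z u c & phi u c = w &
      forall u v c k, xle u v -> Z u c ->
        phi v c ord0 k = if live v k then phi u c ord0 k else 0].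

(* [D] is Dg(f). The intervals are required to be nonempty, as zero modules do
   not contribute points. *)
Definition is_dgm (D : dgm) :=
  (forall p, p \in D -> xlt (birth p) (death p)) /\
  forall n, interval_decomposition n [seq p <- D | pdim p == n].

End persistence.

Notation dgm R := {mset dpoint R}%mset.

Section bottleneck.
Variable R : realType.
Implicit Types (D : dgm R) (G : seq (dpoint R * dpoint R)).

Definition linf (p q : R * R) : R := Num.max `|p.1 - q.1| `|p.2 - q.2|.
Definition diag_dist (p : R * R) : R := inf [set linf p (z, z) | z in setT].

Definition matched1 G : dgm R := seq_mset [seq g.1 | g <- G].
Definition matched2 G : dgm R := seq_mset [seq g.2 | g <- G].

Definition partial_matching D D' G :=
  [/\ forall g, g \in G -> pdim g.1 = pdim g.2 /\ ptyp g.1 = ptyp g.2,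
      (matched1 G `<=` D)%mset & (matched2 G `<=` D')%mset].

Definition cost D D' G : R :=
  Num.max (\big[Num.max/0]_(g <- G) linf (pxy g.1) (pxy g.2))
    (Num.max (\big[Num.max/0]_(p <- (D `\` matched1 G)%mset) diag_dist (pxy p))
       (\big[Num.max/0]_(p <- (D' `\` matched2 G)%mset) diag_dist (pxy p))).

Definition bottleneck D D' : R :=
  inf [set cost D D' G | G in partial_matching D D'].

End bottleneck.

Section gomics.
Variable R : realType.
Implicit Types (Z I J : set R) (cov : set (set R)).

Definition open_interval_of Z I := exists J : set R,
  [/\ open J, is_interval J & I = J `&` Z].

Definition proper_part cov I : set R :=
  I `\` \bigcup_(J in [set J | cov J /\ J <> I]) J.

Definition gomic Z cov :=
  [/\ forall I, cov I -> open_interval_of Z I,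
      \bigcup_(I in cov) I = Z,
      forall I, cov I -> ~ I `<=` \bigcup_(J in [set J | cov J /\ J <> I]) J &
      forall I C x, cov I -> path_component R (proper_part cov I) C ->
        C <> [set x]].

Definition lower_end I : \bar R := ereal_inf [set x%:E | x in I].
Definition upper_end I : \bar R := ereal_sup [set x%:E | x in I].

(* The supremum is taken in [0, +oo], so that the empty cover (of the empty
   set) has granularity 0. *)
Definition granularity cov : \bar R :=
  ereal_sup ([set 0%E] `|` [set (upper_end I - lower_end I)%E | I in cov]).

Definition below cov I J :=
  forall x y, proper_part cov I x -> proper_part cov J y -> x < y.
Definition right_below cov I J :=
  [/\ cov I, below cov I J &
      ~ exists K, [/\ cov K, below cov I K & below cov K J]].
Definition right_above cov I J :=
  [/\ cov I, below cov J I &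
      ~ exists K, [/\ cov K, below cov J K & below cov K I]].

Definition lower_overlap cov I : set R :=
  I `&` \bigcup_(J in [set J | right_below cov J I]) J.
Definition upper_overlap cov I : set R :=
  I `&` \bigcup_(J in [set J | right_above cov J I]) J.

Definition Qplus I : set (R * R) :=
  [set p | (lower_end I <= p.1%:E)%E /\ p.1 <= p.2 /\
           (p.2%:E <= upper_end I)%E].
Definition Qminus I : set (R * R) :=
  [set p | (lower_end I <= p.2%:E)%E /\ p.2 < p.1 /\
           (p.1%:E <= upper_end I)%E].

Definition Q_O cov := \bigcup_(I in cov)
  Qplus (proper_part cov I `|` upper_overlap cov I).
Definition Q_R cov := \bigcup_(I in cov)
  Qminus (proper_part cov I `|` lower_overlap cov I).
Definition Q_Eminus cov := \bigcup_(I in cov) Qminus I.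

Definition staircase cov (t : ptype) : set (R * R) :=
  match t with Ord => Q_O cov | Ext => Q_Eminus cov | Rel => Q_R cov end.

(* The signature of the MultiNerve Mapper, [D] being the diagram of the map
   induced on the Reeb graph. *)
Definition signature cov (D : dgm R) : dgm R :=
  seq_mset [seq p <- D | `[< ~ staircase cov (ptyp p) (pxy p) >]].

End gomics.

(* Multigraph, whose edge e joins u and v when [ends e u v] or [ends e v u]. When
   the graph is drawn over the real line, [ends e u v] holds only for u the
   lower end of e and v the upper one. *)
Record multigraph := Multigraph {
  vert : Type;
  edge : Type;
  ends : edge -> vert -> vert -> Prop }.

Definition incident (G : multigraph) (e : edge G) (u v : vert G) :=
  ends e u v \/ ends e v u.

Definition graph_iso (G H : multigraph) :=
  exists (phi : vert G -> vert H) (psi : edge G -> edge H),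
  [/\ bijective phi, bijective psi &
      forall e u v, incident e u v <-> incident (psi e) (phi u) (phi v)].

(* Each vertex v of S is replaced by (v, false) below (v, true), which are joined
   by the new edge [inr v]; a vertex v outside S is kept as (v, false). *)
Definition split_vertices (G : multigraph) (S : set (vert G)) : multigraph :=
  @Multigraph {w : vert G * bool | w.2 -> S w.1} (edge G + {v | S v})
    (fun e u v => let u := sval u in let v := sval v in
      match e with
      | inl e => [/\ ends e u.1 v.1, (u.2 <-> S u.1) & ~~ v.2]
      | inr w => u = (sval w, false) /\ v = (sval w, true)
      end).

(* Each edge e is subdivided k e times: the new vertices (e, 0), ...,
   (e, k e - 1) are inserted from its lower to its upper end. *)
Section subdivision.
Variables (G : multigraph) (k : edge G -> nat).

Definition sub_vert := (vert G + {w : edge G * nat | (w.2 < k w.1)%N})%type.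

Definition sub_point (e : edge G) (i : nat) (p : sub_vert) :=
  match p with
  | inl u => exists v, (i = 0%N /\ ends e u v) \/ (i = (k e).+1 /\ ends e v u)
  | inr w => (sval w).1 = e /\ i = (sval w).2.+1
  end.

Definition subdivide : multigraph :=
  @Multigraph sub_vert {w : edge G * nat | (w.2 <= k w.1)%N}
    (fun e p q => sub_point (sval e).1 (sval e).2 p /\
                  sub_point (sval e).1 (sval e).2.+1 q).
End subdivision.

Section graphs.
Variables (R : realType) (X : topologicalType) (f : X -> R).

Definition multinerve_mapper (cov : set (set R)) : multigraph :=
  @Multigraph
    {u : set R * set X | cov u.1 /\ path_component R (f @^-1` u.1) u.2}
    {e : set (set R) * set X | exists I J, [/\ cov I, cov J, I <> J,
       e.1 = [set I; J] & path_component R (f @^-1` (I `&` J)) e.2]}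
    (fun e u v => let e := sval e in let u := sval u in let v := sval v in
      [/\ u.1 <> v.1, e.1 = [set u.1; v.1], e.2 `<=` u.2 & e.2 `<=` v.2]).

Definition consecutive (crit : seq R) (a b : R) :=
  [/\ a \in crit, b \in crit, a < b & forall c, c \in crit -> ~ (a < c < b)].

(* The edges are the components of the open slabs between consecutive critical
   levels. An edge is attached to a node when it can be prolonged to it by a
   path. *)
Definition reeb_multigraph (crit : seq R) : multigraph :=
  @Multigraph
    {u : set X | exists2 a, a \in crit & path_component R (f @^-1` [set a]) u}
    {e : R * R * set X | consecutive crit e.1.1 e.1.2 /\
       path_component R (f @^-1` oslab e.1.1%:E e.1.2%:E) e.2}
    (fun e u v => let e := sval e in let u := sval u in let v := sval v in
      [/\ u `<=` f @^-1` [set e.1.1], v `<=` f @^-1` [set e.1.2],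
          (exists x y, [/\ e.2 x, u y & joined R (e.2 `|` u) x y]) &
          (exists x y, [/\ e.2 x, v y & joined R (e.2 `|` v) x y])]).

End graphs.

(* Main.v *)
(** A point of the diagram lies in the staircase only if both its coordinates lie
    between the ends of one interval of the cover; its span is then at most the
    granularity, and the matching of the signature with itself leaves only such
    points unmatched.

    For the isomorphism, no interval of the cover contains two critical values.
    Over an interval K with at most one critical value, sliding along the
    product structures retracts the preimage of K onto any one level t0 of K,
    which has to be the critical one if there is one. Continuity at the critical
    level uses compactness of the fibres and separation of X. Hence shrinking K
    to an interval that still contains t0 does not change the path components.
    The cover is finite, and listing it from left to right as I_0, I_1, ... makes
    only consecutive intervals meet. A node of the Reeb graph is split when its
    level lies in two intervals of the cover, and an arc is subdivided once for
    every interval lying strictly between its two levels. *)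

Require Import Defs.
From mathcomp Require Import all_boot all_order all_algebra.
From mathcomp Require Import finmap multiset.
From mathcomp Require Import all_classical all_reals.
From mathcomp Require Import ereal topology normedtype.
From mathcomp Require Import lra zify.

Import Order.TTheory GRing.Theory Num.Theory.
Import numFieldNormedType.Exports.

Local Open Scope classical_set_scope.
Local Open Scope ring_scope.

Set Implicit Arguments.
Unset Strict Implicit.
Unset Printing Implicit Defensive.

(** * The signature as a sub-multiset of the diagram *)

Section Signature.
Variables (R : realType) (cov : set (set R)) (eps : R).
Hypothesis coveps : (granularity cov <= eps%:E)%E.

(** Pieces of the two graphs are matched by a relation, namely equal index in the cover and a common
    point of the two components. A relation is convenient because the inclusions have no fixed
    direction: a critical level is contained in every element of the cover that meets it, whereas an
    element strictly between two critical levels is contained in the open slab of an arc. In both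
    cases the inclusion is bijective on path components, and having a common point is then a
    bijective relation. A further obstacle is that the range of [f] may have gaps, so that an
    element of the cover is a priori only the trace of an interval. A gap inside an element would be
    flanked by two critical values of that element, which the bound on [eps] forbids. Boundedness of
    the range leaves no values beyond the extreme critical ones. The range is thus a finite union of
    segments between critical values, hence compact, and this is the source of the finiteness of the
    cover. *)

Lemma span_le_granularity (A I : set R) (x y : R) : cov I -> A `<=` I ->
  (lower_end A <= x%:E)%E -> (y%:E <= upper_end A)%E -> y - x <= eps.
Proof.
move=> cI AI Ax Ay; rewrite -lee_fin; apply: le_trans coveps.
apply: (@le_trans _ _ (upper_end I - lower_end I)%E); last first.
  by apply: ereal_sup_ubound; right; exists I.
rewrite EFinB; apply: leeB.
- by apply: le_trans Ay _; apply: ereal_sup_le => _ [z Az <-]; exists z; [exact: AI|].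
- by apply: le_trans Ax; apply: ereal_inf_le_tmp => _ [z Az <-]; exists z; [exact: AI|].
Qed.

(** The supremum in [granularity] is taken over a set containing [0], so the empty cover is no
    exception. *)
Lemma granularity_ge0 : 0 <= eps.
Proof.
by rewrite -lee_fin; apply: le_trans coveps; apply: ereal_sup_ubound; left.
Qed.

(** Each staircase is built from subsets of single elements of the cover, and passing to a subset
    only moves the ends inwards. *)
Lemma staircase_span (t : ptype) (p : R * R) :
  staircase cov t p -> `|p.2 - p.1| <= eps.
Proof.
have le_norm (x y : R) : x <= y -> y - x <= eps ->
    `|y - x| <= eps /\ `|x - y| <= eps.
  by move=> xy; rewrite distrC ler0_norm ?subr_le0 // opprB.
have sub (I A : set R) : proper_part cov I `|` I `&` A `<=` I by move=> x [[]|[]].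
case: t => -[I cI] [lo [xy up]].
- by have [] := le_norm _ _ xy (span_le_granularity cI (@sub I _) lo up).
- by have [] := le_norm _ _ (ltW xy) (span_le_granularity cI (@sub I _) lo up).
- by have [] := le_norm _ _ (ltW xy) (span_le_granularity cI (@subset_refl _ _) lo up).
Qed.

Lemma signatureE (D : dgm R) p : signature cov D p =
  if `[< ~ staircase cov (ptyp p) (pxy p) >] then D p else 0%N.
Proof.
rewrite mset_seqE count_filter.
case: ifP => [sp|/negbT/asboolPn/contrapT sp].
  rewrite -count_mem_mset; apply: eq_count => q /=.
  by case: eqP => //= ->; rewrite sp.
rewrite -(count_pred0 (enum_mset D)); apply: eq_count => q /=.
by case: eqP => //= ->; apply/asboolPn; apply.
Qed.

Lemma signature_sub (D : dgm R) : (signature cov D `<=` D)%mset.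
Proof. by apply/msubsetP => p; rewrite signatureE; case: ifP. Qed.

Lemma long_points_sub_signature (D : dgm R) :
  (seq_mset [seq p <- D | ~~ (pspan p <= eps)] `<=` signature cov D)%mset.
Proof.
apply/msubsetP => p; rewrite signatureE; case: asboolP => [_|/contrapT sp].
  rewrite mset_seqE count_filter -count_mem_mset.
  by apply: sub_count => q /= /andP[].
rewrite leqn0 mset_seqE; apply/eqP/count_memPn; rewrite mem_filter negb_and negbK.
by rewrite [pspan p <= _](staircase_span sp).
Qed.

Lemma missing_point_span (D : dgm R) p :
  p \in (D `\` signature cov D)%mset -> pspan p <= eps.
Proof.
rewrite in_msetB signatureE; case: asboolP => [_|/contrapT sp _].
  by rewrite ltnn.
exact: staircase_span sp.
Qed.

Lemma signature_id (D : dgm R) :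
  (forall p, p \in D -> eps < pspan p) -> signature cov D = D.
Proof.
move=> Deps; apply/eqP; rewrite eqEmsubset signature_sub /=.
apply/msubsetP => p; rewrite leqNgt -in_msetB; apply/negP => pD.
have := missing_point_span pD; rewrite leNgt Deps //.
by apply: msubset_subset pD; apply: msubsetDl.
Qed.

Lemma linf_ge0 (p q : R * R) : 0 <= linf p q.
Proof. by rewrite le_max normr_ge0. Qed.

Lemma diag_dist_le (p : R * R) : `|p.2 - p.1| <= eps -> diag_dist p <= eps / 2.
Proof.
(* The nearest diagonal point in the sup norm has the mean of the two coordinates; it is at half the
   span, whence [eps / 2]. *)
move=> peps; apply: (@le_trans _ _ (linf p ((p.1 + p.2) / 2, (p.1 + p.2) / 2))).
  by apply: ge_inf; [exists 0 => _ [z _ <-]; exact: linf_ge0|exists ((p.1 + p.2) / 2)].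
move: peps; rewrite /linf /= ge_max !ler_norml => /andP[? ?].
by apply/andP; split; apply/andP; split; lra.
Qed.

Lemma bottleneck_signature (D : dgm R) :
  bottleneck (signature cov D) D <= eps / 2.
Proof.
have eps2 : 0 <= eps / 2 by rewrite divr_ge0 // granularity_ge0.
pose G := [seq (p, p) | p <- signature cov D].
have G1 : matched1 G = signature cov D.
  by rewrite /matched1 -map_comp map_id_in ?seq_mset_id.
have G2 : matched2 G = signature cov D.
  by rewrite /matched2 -map_comp map_id_in ?seq_mset_id.
apply: (@le_trans _ _ (cost (signature cov D) D G)).
  (* The infimum is a lower bound because the costs are bounded below: each is a maximum with
     [0]. *)
  apply: ge_inf.
    by exists 0 => _ [H _ <-]; rewrite le_max bigmax_ge_id.
  exists G => //; split; rewrite ?G1 ?G2 ?signature_sub ?msubset_refl //.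
  by move=> _ /mapP[p _ ->].
rewrite /cost G1 G2 msetBxx !ge_max; apply/and3P; split.
- rewrite big_map; apply: bigmax_le => // p _.
  by rewrite /linf /= !subrr normr0 maxxx.
- by rewrite enum_mset0 big_nil.
- rewrite big_seq; apply: bigmax_le => // p /missing_point_span.
  exact: diag_dist_le.
Qed.

End Signature.
(** * Retractions onto level sets *)

Section Flow.
Variables (R : realType) (X : topologicalType) (f : X -> R).
Hypothesis cf : continuous f.

(* The last clause says that [fl^~ c] is continuously extended by the identity to
   the level c, also when c is an end of the slab. *)
Definition slab_flow (a b : \bar R) (fl : X -> R -> X) :=
  [/\ forall x, oslab a b (f x) -> fl x (f x) = x,
      forall x s, oslab a b (f x) -> cslab a b s -> f (fl x s) = s,
      forall x, oslab a b (f x) -> {within cslab a b, continuous (fl x)},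
      forall x s, oslab a b (f x) -> cslab a b s ->
        {for x, continuous (fl^~ s)} &
      forall c x W, cslab a b c -> f x = c -> nbhs x W ->
        \forall y \near x, oslab a b (f y) -> W (fl y c)].

Lemma oslab_cslab (a b : \bar R) : oslab a b `<=` cslab a b.
Proof. by move=> t /andP[? ?]; apply/andP; split; exact: ltW. Qed.

Lemma oslab_segment (a b : \bar R) (c t s : R) : cslab a b c -> oslab a b t ->
  (c < s <= t) || (t <= s < c) -> oslab a b s.
Proof.
move=> /andP[ac cb] /andP[at_ tb] /orP[]/andP[h1 h2]; apply/andP; split.
- by apply: le_lt_trans ac _; rewrite lte_fin.
- by apply: le_lt_trans tb; rewrite lee_fin.
- by apply: lt_le_trans at_ _; rewrite lee_fin.
- by apply: lt_le_trans cb; rewrite lte_fin.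
Qed.

Lemma open_oslab (a b : \bar R) : open (oslab a b).
Proof.
have -> : oslab a b = [set t : R | (a < t%:E)%E] `&` [set t : R | (t%:E < b)%E].
  by apply/seteqP; split => t /= => [/andP[]|[? ?]] //; apply/andP.
apply: openI.
- case: a => [a| |].
  + rewrite (_ : [set _ | _] = [set t | a < t]); first exact: open_gt.
    by apply/seteqP; split=> t /=; rewrite lte_fin.
  + by rewrite (_ : [set _ | _] = set0) ?open0 // -subset0 => t /=; rewrite ltNge leey.
  + by rewrite (_ : [set _ | _] = setT); [exact: openT|apply/seteqP; split=> t //= _; exact: ltNyr].
- case: b => [b| |].
  + rewrite (_ : [set _ | _] = [set t | t < b]); first exact: open_lt.
    by apply/seteqP; split=> t /=; rewrite lte_fin.
  + by rewrite (_ : [set _ | _] = setT); [exact: openT|apply/seteqP; split=> t //= _; exact: ltry].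
  + by rewrite (_ : [set _ | _] = set0) ?open0 // -subset0 => t /=; rewrite ltNge leNye.
Qed.

Lemma near_oslab (a b : \bar R) x : oslab a b (f x) ->
  \forall y \near x, oslab a b (f y).
Proof. by move=> fx; apply: cf; apply: open_nbhs_nbhs; split=> //; exact: open_oslab. Qed.

Lemma slab_flow_exists (a b : \bar R) : hausdorff_space X ->
  product_over f a b -> exists fl, slab_flow a b fl.
Proof.
move=> hX [Y [mu [[cY _] [[muAB muS muI] cmu omu] fmu cmub subc]]].
(* An empty slab is treated apart, since [p] needs a default point of [Y]. *)
have [[x0 fx0]|nex] := pselect (exists x, oslab a b (f x)); last first.
  exists (fun x _ => x); split.
  - by move=> x fx; case: nex; exists x.
  - by move=> x s fx; case: nex; exists x.
  - by move=> x fx; case: nex; exists x.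
  - by move=> x s fx; case: nex; exists x.
  - by move=> c x W _ _ _; apply: nearW => y fy; case: nex; exists y.
have [[y0 t0] [_ t0s] mu0] := muI _ fx0.
have /choice[p pP] : forall x, exists y, oslab a b (f x) -> mu (y, f x) = x.
  move=> x; have [fx|nfx] := pselect (oslab a b (f x)); last by exists y0.
  have [[y t] [_ ts] <-] := muI _ fx.
  by exists y; rewrite fmu.
have cmu_at y s : cslab a b s -> forall W, nbhs (mu (y, s)) W ->
    \forall y' \near y & s' \near s, cslab a b s' -> W (mu (y', s')).
  move=> cs W nW; have /subspace_continuousP/(_ (y, s)) := cmub.
  move=> /(_ (conj Logic.I cs) _ nW); rewrite /nbhs/= /within /=.
  by apply: filterS => -[y' s'] /= h cs'; apply: h.
have cmuy s : cslab a b s -> continuous (fun y => mu (y, s)).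
  move=> cs y W nW; have [[P Q] [/= nP nQ] PQ] := cmu_at y s cs W nW.
  apply: filterS nP => y' Py'; apply: (PQ (y', s)) => //=.
  by split=> //=; exact: nbhs_singleton.
have cmus y : {within cslab a b, continuous (fun s => mu (y, s))}.
  apply/subspace_continuousP => s cs W nW.
  have [[P Q] [/= nP nQ] PQ] := cmu_at y s cs W nW.
  rewrite /within /=; apply: filterS nQ => s' Qs' cs'; apply: (PQ (y, s')) => //=.
  by split=> //=; exact: nbhs_singleton.
have cp x : oslab a b (f x) -> {for x, continuous p}.
  move=> fx W nW.
  have [V [oV Vpx VW]] : exists V, [/\ open V, V (p x) & V `<=` W].
    by move: nW; rewrite nbhsE => -[V [oV Vx] VW]; exists V.
  have oVT : open (V `*` [set: R]).
    rewrite (_ : _ `*` _ = fst @^-1` V).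
      by apply: open_comp => // ? _; exact: cvg_fst.
    by apply/seteqP; split=> [? []|].
  have [W' oW' hW'] := omu _ oVT.
  have W'x : W' x.
    suff : (f @^-1` oslab a b `&` W') x by case.
    by rewrite -hW'; exists (p x, f x); [split|exact: pP].
  have nW' : nbhs x W' by apply: open_nbhs_nbhs.
  suff : \forall y \near x, V (p y) by apply: filterS => y /VW.
  near=> y.
  have fy : oslab a b (f y) by near: y; exact: near_oslab.
  have : (f @^-1` oslab a b `&` W') y by split=> //; near: y.
  rewrite -hW' => -[[y' t] [[_ /= ts] [/= Vy' _]] muy].
  suff -> : p y = y' by [].
  have e : mu (p y, f y) = mu (y', t) by rewrite pP.
  have : (p y, f y) = (y', t) by apply: muS; rewrite ?inE.
  by case.
exists (fun x s => mu (p x, s)); split.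
- by move=> x /pP.
(* [fmu] speaks of the open slab only; at its ends the equation follows by continuity along the flow
   line. *)
- move=> x s fx cs; apply/eqP; rewrite -subr_eq0; apply/eqP.
  have : {within cslab a b, continuous (fun s => f (mu (p x, s)))}.
    by move=> u; apply: continuous_comp; [exact: cmus|exact: cf].
  move=> /subspace_continuousP /(_ s cs) h.
  apply/eqP; apply/negPn/negP => ne0.
  set e := `|f (mu (p x, s)) - s|; have e0 : 0 < e by rewrite normr_gt0.
  have := h _ (nbhsx_ballx (f (mu (p x, s))) _ (divr_gt0 e0 (ltr0n _ 2))).
  rewrite /within /= => /nbhs_ballP[d /= d0 hd].
  have [fxs|fxs] := eqVneq (f x) s; first by move: ne0; rewrite -fxs pP // subrr eqxx.
  (* A parameter between [s] and [f x], hence in the open slab, so close to [s] that both terms of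
     the final triangle inequality are below [e / 2]. *)
  have [u us ds] : exists2 u, (s < u <= f x) || (f x <= u < s) &
      `|s - u| < Num.min d (e / 2).
    set m := Num.min d (e / 2); have m0 : 0 < m by rewrite lt_min d0 divr_gt0.
    have [lt|lt|e1] := ltgtP s (f x); last by rewrite e1 eqxx in fxs.
    - exists (Num.min (f x) (s + m / 2)).
        by apply/orP; left; rewrite lt_min lt ge_min lexx /= ltrDl divr_gt0.
      by rewrite minEle; case: ifP => h1; rewrite ltr_norml; lra.
    - exists (Num.max (f x) (s - m / 2)).
        by apply/orP; right; rewrite gt_max lt le_max lexx /= gtrDl oppr_lt0 divr_gt0.
      by rewrite maxEle; case: ifP => h1; rewrite ltr_norml; lra.
  have ou : oslab a b u by apply: oslab_segment us.
  move: ds; rewrite lt_min => /andP[ds de].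
  have : `|f (mu (p x, s)) - f (mu (p x, u))| < e / 2.
    exact: hd u ds (oslab_cslab ou).
  rewrite (fmu _ _ ou) => h1.
  have := ler_distD u (f (mu (p x, s))) s; rewrite -/e (distrC u s).
  by move=> /le_lt_trans/(_ (ltrD h1 de)); rewrite -splitr ltxx.
- by move=> x _; exact: cmus.
- move=> x s fx cs; apply: (@continuous_comp _ _ _ p (fun y => mu (y, s))).
    exact: cp.
  exact: cmuy.
- move=> c x W cc fxc nW.
  (* The premise [x' = mu (y, f x')] stands for [y = p x']. It lets [y] range over all of [Y], so
     that compactness applies without any limit of [p x']. *)
  have h : \forall x' \near x, [set: Y] `<=`
      fun y => oslab a b (f x') -> x' = mu (y, f x') -> W (mu (y, c)).
    (* If [mu (y, c)] is not in W, it can be separated from x, so that no x'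
       near x equals [mu (y', f x')] for y' near y. *)
    apply: ((compact_near_coveringP [set: Y]).1 cY).
    move=> y _; have [Wy|nWy] := pselect (nbhs (mu (y, c)) W).
      have := cmuy _ cc _ _ Wy => ny.
      exists ([set y' | W (mu (y', c))], setT) => //=.
        by split=> //; exact: filterT.
      by move=> [y' x'] [/= ].
    have xne : x != mu (y, c).
      by apply/eqP => e; apply: nWy; rewrite -e.
    move: hX; rewrite open_hausdorff => /(_ _ _ xne) [[A B] /= [xA yB] [oA oB AB]].
    have nB : nbhs (mu (y, c)) B by apply: open_nbhs_nbhs; split=> //; rewrite inE in yB.
    have [[P Q] [/= nP nQ] PQ] := cmu_at y c cc _ nB.
    exists (P, A `&` f @^-1` Q) => /=.
      split=> //; apply: filterI.
        by apply: open_nbhs_nbhs; split=> //; rewrite inE in xA.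
      by apply: cf; rewrite fxc.
    move=> [y' x'] [/= Py' [Ax' Qx']] ox' e; exfalso.
    have Bx' : B x' by rewrite e; apply: (PQ (y', f x')) => //; exact: oslab_cslab.
    by move: AB => /eqP/seteqP[/(_ x') + _]; apply.
  apply: filterS h => x' h ox'; apply: (h (p x') Logic.I) => //.
  by rewrite pP.
Unshelve. all: by end_near. Qed.
End Flow.

(** * Slabs between neighbouring critical values *)

Section Slabs.
Variables (R : realType) (X : topologicalType) (f : X -> R) (crit : seq R).
Hypothesis fmorse : morse_type f crit.

Definition is_slab (a b : \bar R) :=
  [/\ product_over f a b, (a < b)%E, forall c, c \in crit -> ~ oslab a b c,
      a = -oo%E \/ exists2 c, c \in crit & a = c%:E &
      b = +oo%E \/ exists2 c, c \in crit & b = c%:E].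

(** The shift comes from the leading [-oo] of [slab_ends]: slab [i] ends at the critical value of
    index [i], and slab [i.+1] starts there. *)
Lemma slab_endsS i : (i < size crit)%N -> (slab_ends crit)`_i.+1 = (crit`_i)%:E.
Proof. by move=> ic; rewrite /= nth_rcons size_map ic (nth_map 0). Qed.

Lemma slab_ends_last : (slab_ends crit)`_(size crit).+1 = +oo%E.
Proof. by rewrite /= nth_rcons size_map ltnn eqxx. Qed.

Lemma is_slab_nth i : (i <= size crit)%N ->
  is_slab (slab_ends crit)`_i (slab_ends crit)`_i.+1.
Proof.
case: fmorse => _ scrit po _ ic.
have ltn j k : (k < size crit)%N -> (j < k)%N -> crit`_j < crit`_k.
  by move=> kc jk; apply: (sorted_ltn_nth lt_trans) => //; rewrite inE ?(ltn_trans jk).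
have len j k : (k < size crit)%N -> (j <= k)%N -> crit`_j <= crit`_k.
  by move=> kc; rewrite leq_eqVlt => /predU1P[->//|jk]; apply/ltW/ltn.
split.
- exact: po.
- case: i ic => [|i] ic.
    by case: (posnP (size crit)) => [e|c0]; [rewrite -{2}e slab_ends_last|rewrite slab_endsS //= ltNyr].
  rewrite slab_endsS //; move: ic; rewrite leq_eqVlt => /predU1P[->|ic].
    by rewrite slab_ends_last ltry.
  by rewrite slab_endsS // lte_fin ltn.
- move=> _ /(nthP 0)[j jc <-] /andP[h1 h2].
  have [ji|ij] := ltnP j i.
    case: i ic h1 ji {h2} => // i ic; rewrite slab_endsS // ltnS lte_fin => + ji.
    by rewrite ltNge len.
  have ic' := leq_ltn_trans ij jc.
  by move: h2; rewrite slab_endsS // lte_fin ltNge len.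
- case: i ic => [|i] ic; first by left.
  by right; exists crit`_i; [exact: mem_nth|rewrite slab_endsS].
- move: ic; rewrite leq_eqVlt => /predU1P[->|ic]; first by left; rewrite slab_ends_last.
  by right; exists crit`_i; [exact: mem_nth|rewrite slab_endsS].
Qed.

Lemma slab_below t : t \in crit -> exists a, is_slab a t%:E.
Proof.
move=> tc; exists (slab_ends crit)`_(index t crit).
have := @is_slab_nth (index t crit); rewrite slab_endsS ?index_mem //.
by rewrite nth_index //; apply; rewrite index_size.
Qed.

Lemma slab_above t : t \in crit -> exists b, is_slab t%:E b.
Proof.
move=> tc; exists (slab_ends crit)`_(index t crit).+2.
have := @is_slab_nth (index t crit).+1; rewrite slab_endsS ?index_mem //.
by rewrite nth_index //; apply.
Qed.

Lemma slab_at t : t \notin crit -> exists a b, is_slab a b /\ oslab a b t.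
Proof.
(* The index of the first critical value above [t], or [size crit] if there is none; slab [i] is the
   one that ends there. *)
move=> tc; set i := find (fun c => t < c) crit.
exists (slab_ends crit)`_i, (slab_ends crit)`_i.+1.
have ic : (i <= size crit)%N by exact: find_size.
split; first exact: is_slab_nth.
apply/andP; split.
- case E : i => [|j]; first exact: ltNyr.
  have jc : (j < size crit)%N by rewrite -E.
  rewrite slab_endsS // lte_fin lt_neqAle; apply/andP; split.
    by apply: contraNneq tc => <-; exact: mem_nth.
  by rewrite leNgt (before_find 0 (a := fun c => t < c)) // -/i E.
- move: ic; rewrite leq_eqVlt => /predU1P[->|ic]; first by rewrite slab_ends_last ltry.
  by rewrite slab_endsS // lte_fin; apply: (nth_find 0); rewrite has_find.
Qed.

(** [morse_type] numbers the slabs, while arcs are given by pairs of critical values. The slab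
    through the midpoint has no critical value inside, and none lies strictly between [a] and [b],
    so the ends agree. *)
Lemma consecutive_slab a b : consecutive crit a b -> is_slab a%:E b%:E.
Proof.
move=> [ac bc ab nab].
set t := (a + b) / 2; have [at_ tb] : a < t /\ t < b by rewrite /t; split; lra.
have tc : t \notin crit by apply/negP => /nab; apply; rewrite at_.
have [a' [b' [sl /andP[a't tb']]]] := slab_at tc.
have [_ _ ns ea eb] := sl.
have aa' : (a%:E <= a')%E.
  rewrite leNgt; apply/negP => a'a; apply: (ns a ac); apply/andP; split=> //.
  by apply: lt_trans tb'; rewrite lte_fin.
have bb' : (b' <= b%:E)%E.
  rewrite leNgt; apply/negP => b'b; apply: (ns b bc); apply/andP; split=> //.
  by apply: lt_trans a't _; rewrite lte_fin.
have -> : a%:E = a'.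
  case: ea a't aa' {sl ns} => [->|[c cc ->]]; first by move=> _; rewrite leNgt ltNyr.
  rewrite lte_fin lee_fin => ct ac'; congr EFin; apply/eqP; rewrite eq_le ac' /= leNgt.
  by apply/negP => ac''; apply: (nab c cc); rewrite ac'' (lt_trans ct).
suff -> : b%:E = b' by [].
case: eb tb' bb' {sl ns} => [->|[c cc ->]]; first by move=> _; rewrite leNgt ltry.
rewrite lte_fin lee_fin => ct bc'; congr EFin; apply/eqP; rewrite eq_le bc' andbT leNgt.
by apply/negP => bc''; apply: (nab c cc); rewrite bc'' (lt_trans _ ct).
Qed.

End Slabs.

(** * Retraction of the preimage of an interval onto one level *)

Section Retraction.
Variables (R : realType) (X : topologicalType) (f : X -> R) (crit : seq R).
Hypotheses (fmorse : morse_type f crit) (hX : hausdorff_space X).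

Let cf : continuous f. Proof. by case: fmorse. Qed.

Lemma convex_comb (K : set R) s t u : is_interval K -> K s -> K t ->
  0 <= u <= 1 -> K (s + u * (t - s)).
Proof.
move=> iK Ks Kt /andP[u0 u1]; have [st|/ltW ts] := leP s t.
- by apply: (iK s t) => //; apply/andP; split; nra.
- by apply: (iK t s) => //; apply/andP; split; nra.
Qed.

Lemma joined_curve (K : set R) (g : R -> X) (A : set X) s t :
  {within K, continuous g} ->
  (forall u, 0 <= u <= 1 -> K (s + u * (t - s)) /\ A (g (s + u * (t - s)))) ->
  joined R A (g s) (g t).
Proof.
move=> cg KA; exists (g \o (fun u => s + u * (t - s))); split => /=.
- apply: within_comp cg _.
    apply: continuous_subspaceT => u.
    by apply: cvgD; [exact: cvg_cst|apply: cvgM; [exact: cvg_id|exact: cvg_cst]].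
  by move=> _ [u /= + <-]; rewrite in_itv /= => /KA[].
- by rewrite mul0r addr0.
- by rewrite mul1r addrC subrK.
- by move=> u /KA[].
Qed.

Lemma joined_sub (A B : set X) x y : A `<=` B -> joined R A x y -> joined R B x y.
Proof. by move=> AB [g [? ? ? gA]]; exists g; split=> // t /gA/AB. Qed.

Lemma joined_flow a b fl x (K : set R) s t : slab_flow f a b fl ->
  oslab a b (f x) -> is_interval K -> K `<=` cslab a b -> K s -> K t ->
  joined R (f @^-1` K) (fl x s) (fl x t).
Proof.
move=> [_ ffl cfl _ _] fx iK Kab Ks Kt.
apply: (joined_curve (cfl x fx)) => u u01.
have Ku : K (s + u * (t - s)) by exact: convex_comb.
by split; [exact: Kab|rewrite /preimage /= ffl //; exact: Kab].
Qed.

Lemma is_interval_oslab (a b : \bar R) : is_interval (oslab a b).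
Proof.
move=> x y /andP[ax _] /andP[_ yb] z /andP[xz zy]; apply/andP; split.
  by apply: lt_le_trans ax _; rewrite lee_fin.
by apply: le_lt_trans yb; rewrite lee_fin.
Qed.

Lemma is_interval_cslab (a b : \bar R) : is_interval (cslab a b).
Proof.
move=> x y /andP[ax _] /andP[_ yb] z /andP[xz zy]; apply/andP; split.
  by apply: le_trans ax _; rewrite lee_fin.
by apply: le_trans yb; rewrite lee_fin.
Qed.

Lemma is_intervalI (A B : set R) : is_interval A -> is_interval B ->
  is_interval (A `&` B).
Proof.
by move=> iA iB x y [Ax Bx] [Ay By] z xzy; split; [apply: (iA x y)|apply: (iB x y)].
Qed.

(** The tracks are controlled over every interval [K'] and not only over [K]: after a path over [K]
    has been pushed to the level, its end points are linked to their images over the smaller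
    interval. *)
Definition level_retract (K : set R) (t0 : R) := exists r : X -> X,
  (forall x, K (f x) -> {for x, continuous r}) /\
  forall x, K (f x) -> f (r x) = t0 /\
    forall K', is_interval K' -> K' (f x) -> K' t0 ->
      joined R (f @^-1` K') x (r x).

Lemma joined_flow_to a b fl x (K : set R) t : slab_flow f a b fl ->
  oslab a b (f x) -> cslab a b t -> is_interval K -> K (f x) -> K t ->
  joined R (f @^-1` K) x (fl x t).
Proof.
move=> flP fx ct iK Kx Kt; have [fl0 _ _ _ _] := flP.
have := @joined_flow a b fl x (K `&` cslab a b) (f x) t flP fx.
rewrite fl0 // => j.
apply: (@joined_sub (f @^-1` (K `&` cslab a b))); first by move=> ? [].
apply: j => //; last by split=> //; exact: oslab_cslab.
by apply: is_intervalI => //; exact: is_interval_cslab.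
Qed.

(** For a regular [t0] the flow of one slab suffices. For a critical [t0] the flows of the two
    adjacent slabs are glued along the identity of the level. *)
Lemma level_retract_exists (K : set R) t0 : is_interval K -> K t0 ->
  (forall c, c \in crit -> K c -> c = t0) -> level_retract K t0.
Proof.
move=> iK Kt0 Kc.
(* An end of the slab between [z] and [t0] would be a critical value in [K] different from [t0]. *)
have lo a z : a = -oo%E \/ (exists2 c, c \in crit & a = c%:E) ->
    (a < t0%:E)%E -> K z -> (a < z%:E)%E.
  move=> [->|[c cc ->]]; first by rewrite !ltNyr.
  rewrite !lte_fin => ct Kz; rewrite ltNge; apply/negP => zc.
  have : K c by apply: (iK z t0) => //; rewrite zc ltW.
  by move=> /(Kc c cc) e; rewrite e ltxx in ct.
have hi a z : a = +oo%E \/ (exists2 c, c \in crit & a = c%:E) ->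
    (t0%:E < a)%E -> K z -> (z%:E < a)%E.
  move=> [->|[c cc ->]]; first by rewrite !ltry.
  rewrite !lte_fin => ct Kz; rewrite ltNge; apply/negP => zc.
  have : K c by apply: (iK t0 z) => //; rewrite zc ltW.
  by move=> /(Kc c cc) e; rewrite e ltxx in ct.
have [t0c|t0c] := boolP (t0 \in crit); last first.
  have [a [b [[po _ _ ea eb] t0s]]] := slab_at fmorse t0c.
  have [at_ tb] := andP t0s.
  have [fl flP] := slab_flow_exists cf hX po.
  have [_ ffl _ cfl _] := flP.
  have sK x : K (f x) -> oslab a b (f x).
    by move=> Kx; apply/andP; split; [exact: lo|exact: hi].
  exists (fl^~ t0); split=> [x Kx|x Kx].
    by apply: cfl; [exact: sK|exact: oslab_cslab].
  split; first by apply: ffl; [exact: sK|exact: oslab_cslab].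
  move=> K' iK' K'x K't0; apply: (joined_flow_to flP) => //; first exact: sK.
  exact: oslab_cslab.
have [a [poa at_ _ ea _]] := slab_below fmorse t0c.
have [b [pob tb _ _ eb]] := slab_above fmorse t0c.
have [fm fmP] := slab_flow_exists cf hX poa.
have [fp fpP] := slab_flow_exists cf hX pob.
have [_ ffm _ cfm nfm] := fmP; have [_ ffp _ cfp nfp] := fpP.
have ca : cslab a t0%:E t0 by rewrite /cslab /= lexx andbT ltW.
have cb : cslab t0%:E b t0 by rewrite /cslab /= lexx ltW.
have sa x : K (f x) -> f x < t0 -> oslab a t0%:E (f x).
  by move=> Kx xt; apply/andP; split; [exact: lo|rewrite lte_fin].
have sb x : K (f x) -> t0 < f x -> oslab t0%:E b (f x).
  by move=> Kx xt; apply/andP; split; [rewrite lte_fin|exact: hi].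
pose r x := if f x < t0 then fm x t0 else if t0 < f x then fp x t0 else x.
have rm x : f x < t0 -> r x = fm x t0 by rewrite /r => ->.
have rp x : t0 < f x -> r x = fp x t0.
  by rewrite /r => xt; rewrite xt ltNge ltW.
have r0 x : f x = t0 -> r x = x by rewrite /r => ->; rewrite ltxx.
exists r; split=> [x Kx|x Kx]; last first.
  have [xt|xt|xt] := ltgtP (f x) t0.
  - rewrite rm // ffm; [|exact: sa|exact: ca].
    split=> // K' iK' K'x K't; apply: (joined_flow_to fmP) => //; exact: sa.
  - rewrite rp // ffp; [|exact: sb|exact: cb].
    split=> // K' iK' K'x K't; apply: (joined_flow_to fpP) => //; exact: sb.
  - by rewrite r0 //; split=> // K' iK' K'x K't; exact: joined_refl.
have [xt|xt|xt] := ltgtP (f x) t0.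
- move=> W; rewrite rm // => nW.
  have := cfm x t0 (sa _ Kx xt) ca W nW.
  apply: filterS2 (near_oslab cf (sa _ Kx xt)) => y /andP[_]; rewrite lte_fin.
  by move=> yt /=; rewrite rm.
- move=> W; rewrite rp // => nW.
  have := cfp x t0 (sb _ Kx xt) cb W nW.
  apply: filterS2 (near_oslab cf (sb _ Kx xt)) => y /andP[+ _]; rewrite lte_fin.
  by move=> yt /=; rewrite rp.
(* At the critical level, the last clause of [slab_flow] gives continuity from each side
   separately. *)
- move=> W; rewrite r0 // => nW.
  have na := nfm t0 x W ca xt nW.
  have nb := nfp t0 x W cb xt nW.
  have nab : \forall y \near x, oslab a b (f y).
    by apply: near_oslab => //; rewrite xt; apply/andP.
  have : \forall y \near x, W y /\ oslab a b (f y) by exact: filterI.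
  apply: filterS3 na nb => y wa wb [wy /andP[ay yb]] /=.
  have [yt|yt|yt] := ltgtP (f y) t0.
  + by rewrite rm //; apply: wa; rewrite /oslab /= ay lte_fin.
  + by rewrite rp //; apply: wb; rewrite /oslab /= yb lte_fin andbT.
  + by rewrite r0.
Qed.

(* The retraction pushes a path over K onto the level t0, hence over K'. *)
Lemma joined_shrink (K K' : set R) t0 x y : is_interval K -> is_interval K' ->
  K' `<=` K -> K' t0 -> (forall c, c \in crit -> K c -> c = t0) ->
  K' (f x) -> K' (f y) ->
  joined R (f @^-1` K) x y -> joined R (f @^-1` K') x y.
Proof.
move=> iK iK' K'K K't Kc K'x K'y [g [cg g0 g1 gK]].
have [r [cr rP]] := level_retract_exists iK (K'K _ K't) Kc.
have [_ jx] := rP _ (K'K _ K'x); have [_ jy] := rP _ (K'K _ K'y).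
apply: joined_trans (jx _ iK' K'x K't) _.
apply: joined_trans (joined_sym (jy _ iK' K'y K't)).
exists (r \o g); split => /=; rewrite ?g0 ?g1 //.
  apply: within_comp cg _ _; last by move=> _ [t /= + <-]; rewrite in_itv /= => /gK; apply.
  apply/subspace_continuousP => z Kz.
  by apply: cvg_within_filter; exact: cr.
by move=> t /gK Kt; rewrite /preimage /= (rP _ Kt).1.
Qed.

Lemma joined_level (K : set R) t0 x : is_interval K -> K t0 -> K (f x) ->
  (forall c, c \in crit -> K c -> c = t0) ->
  exists2 x', f x' = t0 & joined R (f @^-1` K) x x'.
Proof.
move=> iK Kt0 Kx Kc; have [r [_ rP]] := level_retract_exists iK Kt0 Kc.
by have [fr jr] := rP _ Kx; exists (r x) => //; exact: jr.
Qed.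
End Retraction.

(** * Bijections from relations, and bijections on path components *)

Lemma sval_inj (T : Type) (P : T -> Prop) (u v : {x | P x}) :
  sval u = sval v -> u = v.
Proof.
by case: u v => [x Px] [y Py] /= e; subst y; congr exist; exact: Prop_irrelevance.
Qed.

(** Both the map and its inverse are chosen from the relation; uniqueness on each side makes them
    inverse to each other. *)
Lemma correspondence_bij (A B : Type) (r : A -> B -> Prop) :
  (forall a, exists b, r a b) -> (forall b, exists a, r a b) ->
  (forall a b b', r a b -> r a b' -> b = b') ->
  (forall a a' b, r a b -> r a' b -> a = a') ->
  exists2 phi : A -> B, bijective phi & forall a, r a (phi a).
Proof.
move=> /choice[phi phiP] /choice[psi psiP] fr ir; exists phi => //.
exists psi => [a|b]; first exact: ir (psiP _) (phiP _).
exact: fr (phiP _) (psiP _).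
Qed.

(** Edges of the MultiNerve Mapper carry unordered pairs of elements; this recovers the two members
    up to exchange. *)
Lemma set2_cases (T : Type) (x y a b : T) : x <> y ->
  [set x; y] = [set a; b] -> (x = a /\ y = b) \/ (x = b /\ y = a).
Proof.
move=> xy e.
have [xa|xb] : [set a; b] x by rewrite -e; left.
  have [ya|yb] : [set a; b] y by rewrite -e; right.
    by case: xy; rewrite xa ya.
  by left.
have [ya|yb] : [set a; b] y by rewrite -e; right.
  by right.
by case: xy; rewrite xb yb.
Qed.

Lemma is_interval_level (R : realType) (a : R) : is_interval [set a].
Proof. by move=> x y -> -> z; rewrite -eq_le => /eqP. Qed.

Section Components.
Variables (R : realType) (T : topologicalType).
Implicit Types A B C D : set T.

Lemma pcomp_sub A C : path_component R A C -> C `<=` A.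
Proof. by move=> [x Ax ->] y [g [_ _ <- gA]]; apply: gA; lra. Qed.

Lemma pcomp_of A x : A x -> exists2 C, path_component R A C & C x.
Proof. by move=> Ax; exists [set y | joined R A x y]; [exists x|exact: joined_refl]. Qed.

Lemma pcomp_nonempty A C : path_component R A C -> exists x, C x.
Proof. by move=> [x Ax ->]; exists x; exact: joined_refl. Qed.

Lemma pcomp_joined A C x y : path_component R A C -> C x -> C y ->
  joined R A x y.
Proof. by move=> [z Az ->] zx zy; apply: joined_trans zy; exact: joined_sym. Qed.

Lemma pcomp_closed A C x y : path_component R A C -> C x ->
  joined R A x y -> C y.
Proof. by move=> [z Az ->] zx; exact: joined_trans. Qed.

Lemma pcomp_eq A C D x : path_component R A C -> path_component R A D ->
  C x -> D x -> C = D.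
Proof.
move=> cC cD Cx Dx; apply/seteqP; split=> y h.
  by apply: pcomp_closed cD Dx _; exact: pcomp_joined cC Cx h.
by apply: pcomp_closed cC Cx _; exact: pcomp_joined cD Dx h.
Qed.

Definition overlap C D := exists x, C x /\ D x.

Lemma overlap_sym C D : overlap C D -> overlap D C.
Proof. by move=> [x []]; exists x. Qed.

(* Inclusion induces a bijection on path components. *)
Definition pi0_equiv A B := [/\ A `<=` B,
  forall x y, A x -> A y -> joined R B x y -> joined R A x y &
  forall x, B x -> exists2 y, A y & joined R B x y].

(** Both directions occur: a node lives over a level contained in an element of the cover, an arc
    over a slab that contains elements. *)
Definition pi0_linked A B := pi0_equiv A B \/ pi0_equiv B A.

Lemma pi0_linked_sym A B : pi0_linked A B -> pi0_linked B A.
Proof. by move=> [|]; [right|left]. Qed.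

Lemma pi0_equiv_overlap A B C D : pi0_equiv A B -> path_component R A C ->
  path_component R B D -> overlap C D -> C `<=` D.
Proof.
move=> [AB _ _] cC cD [x [Cx Dx]] y Cy; apply: pcomp_closed cD Dx _.
by apply: joined_sub AB _; exact: pcomp_joined cC Cx Cy.
Qed.

(** If [A] is contained in [B], any point of [C] serves; otherwise surjectivity on components moves
    a point of [C] into [B]. *)
Lemma linked_component A B C : pi0_linked A B -> path_component R A C ->
  exists2 D, path_component R B D & overlap C D.
Proof.
move=> AB cC; have [x Cx] := pcomp_nonempty cC.
have Ax := pcomp_sub cC Cx.
case: AB => [[AB _ _]|[_ _ BA]].
  by have [D cD Dx] := pcomp_of (AB _ Ax); exists D => //; exists x.
have [y By xy] := BA _ Ax.
have [D cD Dy] := pcomp_of By; exists D => //; exists y; split=> //.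
exact: pcomp_closed cC Cx xy.
Qed.

Lemma linked_unique A B C D D' : pi0_linked A B -> path_component R A C ->
  path_component R B D -> path_component R B D' ->
  overlap C D -> overlap C D' -> D = D'.
Proof.
move=> AB cC cD cD' [x [Cx Dx]] [y [Cy Dy]].
have j := pcomp_joined cC Cx Cy.
apply: (@pcomp_eq B _ _ y) => //; apply: (pcomp_closed cD Dx).
case: AB => [[AB _ _]|[_ h _]]; first exact: joined_sub j.
by apply: h => //; [exact: pcomp_sub cD _ Dx|exact: pcomp_sub cD' _ Dy].
Qed.
End Components.
(** * The cover as a sequence of intervals *)

Section Cover.
Variables (R : realType) (X : topologicalType) (f : X -> R) (crit : seq R).
Variables (cov : set (set R)) (eps : R).
Hypotheses (fmorse : morse_type f crit) (hX : hausdorff_space X).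
Hypotheses (bf : bounded_set (range f)) (covgomic : gomic (range f) cov).
Hypothesis coveps : (granularity cov <= eps%:E)%E.
Hypothesis crit_gap :
  forall a b, a \in crit -> b \in crit -> a <> b -> eps < `|a - b|.

Let cf : continuous f. Proof. by case: fmorse. Qed.

(** The flow line through one point over the open slab takes every value from [a] to [b], ends
    included. *)
Lemma segment_range a b t : consecutive crit a b -> range f t -> a < t < b ->
  `[a, b] `<=` range f.
Proof.
move=> /(consecutive_slab fmorse)[po _ _ _ _] [x _ <-] abx.
have [fl [_ ffl _ _ _]] := slab_flow_exists cf hX po.
move=> s; rewrite /= in_itv /= => sab; exists (fl x s) => //.
by rewrite ffl // /oslab /cslab /= ?lte_fin ?lee_fin.
Qed.

(** An infinite end of the slab around [t] is impossible: the flow would reach values of arbitrarily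
    large modulus, while the range is bounded. *)
Lemma consecutive_around t : range f t -> t \notin crit ->
  exists a b, [/\ consecutive crit a b, a < t < b & `[a, b] `<=` range f].
Proof.
move=> [x _ fx] tc.
have [a [b [[po _ ns ea eb] abt]]] := slab_at fmorse tc.
have [fl [_ ffl _ _ _]] := slab_flow_exists cf hX po.
have {}ffl s : oslab a b s -> range f s.
  move=> abs; exists (fl x s) => //; apply: ffl; first by rewrite fx.
  exact: oslab_cslab.
(* [bounded_set] only provides bounds strictly above [M]; with [M + 1] as bound, values of modulus
   at least [M + 2] contradict it. *)
have [M [_ /(_ (M + 1))]] := bf; rewrite ltrDl => /(_ ltr01) hM.
have [at_ tb] := andP abt.
have {}eb : exists2 c, c \in crit & b = c%:E.
  case: eb => // e; exfalso; have := hM (Num.max t (M + 2)).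
  have : oslab a b (Num.max t (M + 2)).
    by rewrite /oslab /= e ltry andbT (lt_le_trans at_) // lee_fin le_max lexx.
  move=> /ffl h /(_ h) /=; rewrite leNgt => /negP; apply.
  apply: lt_le_trans (ler_norm _); rewrite lt_max; apply/orP; right; lra.
have {}ea : exists2 c, c \in crit & a = c%:E.
  case: ea => // e; exfalso; have := hM (Num.min t (- M - 2)).
  have : oslab a b (Num.min t (- M - 2)).
    by rewrite /oslab /= e ltNyr /= (le_lt_trans _ tb) // lee_fin ge_min lexx.
  move=> /ffl h /(_ h) /=; rewrite leNgt => /negP; apply.
  rewrite -normrN; apply: lt_le_trans (ler_norm _).
  by rewrite ltrNr gt_min; apply/orP; right; lra.
move: ea eb ns abt {at_ tb ffl po} => [c cc ->] [d dc ->] ns abt.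
rewrite /oslab /= !lte_fin in abt.
have [ct td] := andP abt.
have ccd : consecutive crit c d.
  by split=> //; exact: lt_trans td.
exists c, d; split; [exact: ccd|exact: abt|].
by apply: (segment_range ccd _ abt); exists x.
Qed.

Lemma cov_crit_unique I a b : cov I -> a \in crit -> b \in crit -> I a -> I b ->
  a = b.
Proof.
move=> cI; wlog ab : a b / a <= b => [wl|] ac bc Ia Ib.
  by have [/wl->//|/ltW/wl->//] := leP a b.
apply: contrapT => ne; have := crit_gap ac bc ne.
rewrite distrC ger0_norm ?subr_ge0 // ltNge => /negP; apply.
apply: (span_le_granularity coveps cI (@subset_refl _ I)).
  by apply: ereal_inf_lbound; exists a.
by apply: ereal_sup_ubound; exists b.
Qed.

(** A gap of the range between [x] and [y] would have a critical value on either side of it, both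
    still in the interval cut out by [x] and [y] and in the range, hence both in [I], against
    [cov_crit_unique]. *)
Lemma cov_interval I : cov I -> is_interval I.
Proof.
move=> cI; have [/(_ I cI)[J [_ iJ IJ]] _ _ _] := covgomic.
move=> x y Ix Iy z /andP[xz zy].
have [Zx Zy] : range f x /\ range f y by move: Ix Iy; rewrite IJ => -[_ ?] [_ ?].
have [Jx Jy] : J x /\ J y by move: Ix Iy; rewrite IJ => -[? _] [? _].
have Jz : J z by apply: (iJ x y) => //; rewrite xz.
suff Zz : range f z by rewrite IJ.
apply: contrapT => nZz.
have [xz' zy'] : x < z /\ z < y.
  by split; rewrite lt_neqAle ?xz ?zy andbT; apply/eqP => e; apply: nZz; [rewrite -e|rewrite e].
have [b [bc Zb xb bz]] : exists b, [/\ b \in crit, range f b, x <= b & b < z].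
  have [xc|xc] := boolP (x \in crit); first by exists x.
  have [a [b [[ac bc ab _] /andP[ax xb] sub]]] := consecutive_around Zx xc.
  exists b; split=> //; [|exact: ltW|].
    by apply: sub; rewrite /= in_itv /= lexx ltW.
  rewrite ltNge; apply/negP => zb; apply: nZz; apply: sub.
  by rewrite /= in_itv /= zb andbT; lra.
have [a [ac Za za ay]] : exists a, [/\ a \in crit, range f a, z < a & a <= y].
  have [yc|yc] := boolP (y \in crit); first by exists y.
  have [a [b' [[ac b'c ab _] /andP[ax xb'] sub]]] := consecutive_around Zy yc.
  exists a; split=> //; [| |exact: ltW].
    by apply: sub; rewrite /= in_itv /= lexx ltW.
  rewrite ltNge; apply/negP => zb; apply: nZz; apply: sub.
  by rewrite /= in_itv /= zb /=; lra.
have Ib : I b by rewrite IJ; split=> //; apply: (iJ x y) => //; lra.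
have Ia : I a by rewrite IJ; split=> //; apply: (iJ x y) => //; lra.
by have := cov_crit_unique cI ac bc Ia Ib; lra.
Qed.

Lemma range_compact : compact (range f).
Proof.
(* Pairs [(t, t)] account for the critical values themselves; pairs in the wrong order give empty
   segments and do no harm. *)
pose P (p : R * R) := `[< `[p.1, p.2] `<=` range f >].
have -> : range f = \big[setU/set0]_(p <- [seq (a, b) | a <- crit, b <- crit] | P p)
    `[p.1, p.2]%classic.
  rewrite -bigcup_seq_cond; apply/seteqP; split=> [t Zt|t [p /= /andP[_ /asboolP]]]; last exact.
  have [tc|tc] := boolP (t \in crit).
    exists (t, t) => /=; last by rewrite in_itv /= lexx.
    rewrite allpairs_f //=.
    by apply/asboolP => s /=; rewrite in_itv /= -eq_le => /eqP<-.
  have [a [b [[ac bc _ _] /andP[ab bt] sub]]] := consecutive_around Zt tc.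
  exists (a, b) => /=; last by rewrite in_itv /= !ltW.
  by rewrite allpairs_f //=; exact/asboolP.
by apply: bigsetU_compact => p _; exact: segment_compact.
Qed.

(** By minimality a finite subcover cannot omit any element: an omitted one would be covered by the
    others. *)
Lemma cov_finite : exists s : seq (set R), forall I, cov I <-> I \in s.
Proof.
have [ci cu cm _] := covgomic.
have /choice[J JP] : forall I : set R, exists J : set R, cov I ->
    [/\ open J, is_interval J & I = J `&` range f].
  move=> I; have [cI|nc] := pselect (cov I); last by exists set0.
  by have [J] := ci _ cI; exists J.
have := range_compact; rewrite compact_cover => /(_ (set R) cov J).
case.
- by move=> I cI; have [] := JP I cI.
- move=> t Zt; have : (\bigcup_(I in cov) I) t by rewrite cu.
  move=> [I cI It]; exists I => //; have [_ _ e] := JP I cI.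
  have : (J I `&` range f) t by rewrite -e.
  by case.
move=> D DP cD; exists (enum_fset D) => I; split=> [cI|ID]; last first.
  by have := DP I ID; rewrite inE.
apply/negPn/negP => nI; apply: (cm I cI) => t It.
have Zt : range f t by rewrite -cu; exists I.
have [K KD Kt] := cD t Zt.
have cK : cov K by have := DP K KD; rewrite inE.
exists K; first by split=> // e; rewrite e in KD; move: nI; rewrite KD.
have [_ _ e] := JP K cK.
suff : (J K `&` range f) t by rewrite -e.
by split.
Qed.

(* The cover sorted from left to right, [c j] being a point of [I j] that lies
   in no other element; [I j] is empty beyond the last element. *)
Lemma cov_enum : exists (I : nat -> set R) (c : nat -> R) (N : nat),
  [/\ forall J, cov J <-> exists2 j, (j < N)%N & J = I j,
      forall j, (j < N)%N -> I j (c j),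
      forall i j, (j < N)%N -> I i (c j) -> i = j,
      forall i j, (i < j < N)%N -> c i < c j &
      forall j t, I j t -> (j < N)%N].
Proof.
have [s sP] := cov_finite; have [ci cu cm _] := covgomic.
have /choice[c cP] : forall I : set R, exists t : R, cov I ->
    I t /\ forall J, cov J -> J t -> J = I.
  move=> I; have [cI|nc] := pselect (cov I); last by exists 0.
  apply: contrapT => nex; apply: (cm I cI) => t It; apply: contrapT => nt.
  apply: nex; exists t => _; split=> // J cJ Jt; apply: contrapT => ne.
  by apply: nt; exists J.
pose le I J := c I <= c J.
pose s' := sort le (undup s).
have s'P I : cov I <-> I \in s' by rewrite mem_sort mem_undup.
have us' : uniq s' by rewrite sort_uniq undup_uniq.
have ss' : sorted le s' by apply: sort_sorted => x y; exact: le_total.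
have cj j : (j < size s')%N -> cov (nth set0 s' j) by move=> js; apply/s'P/mem_nth.
have inj i j : (i < size s')%N -> (j < size s')%N ->
    nth set0 s' i (c (nth set0 s' j)) -> i = j.
  move=> si sj h; have [_ /(_ _ (cj i si) h)/eqP] := cP _ (cj j sj).
  by rewrite nth_uniq // => /eqP.
have out j t : nth set0 s' j t -> (j < size s')%N.
  by move=> h; rewrite ltnNge; apply/negP => sj; rewrite nth_default in h.
exists (nth set0 s'), (fun j => c (nth set0 s' j)), (size s'); split=> //.
- move=> J; split=> [/s'P/(nthP set0)[j js <-]|[j js ->]]; first by exists j.
  exact: cj.
- by move=> j js; have [] := cP _ (cj j js).
- by move=> i j sj h; apply: inj => //; exact: out h.
- move=> i j /andP[ij js]; rewrite lt_neqAle; apply/andP; split.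
    apply/eqP => e; have is_ := ltn_trans ij js.
    have : i = j by apply: inj => //; rewrite -e; have [] := cP _ (cj i is_).
    by move=> ei; rewrite ei ltnn in ij.
  have letr : transitive le by move=> ? ? ?; exact: le_trans.
  have lerefl : reflexive le by move=> ?; exact: lexx.
  have := sorted_leq_nth letr lerefl set0 ss' i j.
  by apply; [rewrite inE (ltn_trans ij)|rewrite inE|exact: ltnW].
Qed.
End Cover.

(** * Order and overlaps of the indexed cover *)

Section IndexedCover.
Variables (R : realType) (X : topologicalType) (f : X -> R) (crit : seq R).
Variables (cov : set (set R)) (eps : R).
Hypotheses (fmorse : morse_type f crit) (hX : hausdorff_space X).
Hypotheses (bf : bounded_set (range f)) (covgomic : gomic (range f) cov).
Hypothesis coveps : (granularity cov <= eps%:E)%E.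
Hypothesis crit_gap :
  forall a b, a \in crit -> b \in crit -> a <> b -> eps < `|a - b|.

Lemma pi0_equiv_intervals (K K' : set R) t0 : is_interval K -> is_interval K' ->
  K' `<=` K -> K' t0 -> (forall c, c \in crit -> K c -> c = t0) ->
  pi0_equiv R (f @^-1` K') (f @^-1` K).
Proof.
move=> iK iK' K'K K't Kc; split.
- by move=> x; exact: K'K.
- by move=> x y K'x K'y; apply: (joined_shrink fmorse hX iK iK' K'K K't Kc).
- move=> x Kx; have [y fy j] := joined_level fmorse hX iK (K'K _ K't) Kx Kc.
  by exists y => //; rewrite /preimage /= fy.
Qed.

Variables (I : nat -> set R) (c : nat -> R) (N : nat).
Hypothesis covE : forall J, cov J <-> exists2 j, (j < N)%N & J = I j.
Hypothesis Ic : forall j, (j < N)%N -> I j (c j).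
Hypothesis Icinj : forall i j, (j < N)%N -> I i (c j) -> i = j.
Hypothesis cmono : forall i j, (i < j < N)%N -> c i < c j.
Hypothesis Iout : forall j t, I j t -> (j < N)%N.

Lemma cov_I j t : I j t -> cov (I j).
Proof. by move=> /Iout jN; apply/covE; exists j. Qed.

Lemma I_itv j : is_interval (I j).
Proof.
move=> x y Ix; apply: (cov_interval fmorse hX bf covgomic coveps crit_gap) => //.
exact: cov_I Ix.
Qed.

Lemma I_crit j a b : a \in crit -> b \in crit -> I j a -> I j b -> a = b.
Proof.
move=> ac bc Ia; apply: (cov_crit_unique coveps crit_gap) => //; exact: cov_I Ia.
Qed.

Lemma I_range j t : I j t -> range f t.
Proof.
move=> It; have [_ <- _ _] := covgomic; exists (I j) => //; exact: cov_I It.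
Qed.

Lemma range_I t : range f t -> exists j, I j t.
Proof.
have [_ <- _ _] := covgomic => -[J /covE[j _ ->]] It; by exists j.
Qed.

(** Otherwise [c j] would lie between [c i] and [x], hence in [I i]. *)
Lemma I_lt i j x : (i < j < N)%N -> I i x -> x < c j.
Proof.
move=> ijN Ix; have /andP[ij jN] := ijN; rewrite ltNge; apply/negP => cx.
have iN := ltn_trans ij jN.
have : I i (c j) by apply: (I_itv (Ic iN) Ix); rewrite cx (ltW (cmono ijN)).
by move=> /(Icinj jN) e; rewrite e ltnn in ij.
Qed.

Lemma I_gt i j x : (i < j)%N -> I j x -> c i < x.
Proof.
move=> ij Ix; have jN := Iout Ix; rewrite ltNge; apply/negP => cx.
have iN := ltn_trans ij jN.
have : I j (c i).
  by apply: (I_itv Ix (Ic jN)); rewrite cx /=; apply/ltW/cmono; rewrite ij.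
by move=> /(Icinj iN) e; rewrite e ltnn in ij.
Qed.

(** If an index lay strictly between [i] and [j], then [x] would be on both sides of [c i.+1]. *)
Lemma I_adj i j x : (i < j)%N -> I i x -> I j x -> j = i.+1.
Proof.
move=> ij Ii Ij; apply/eqP; rewrite eqn_leq ij andbT leqNgt; apply/negP => ij2.
have jN := Iout Ij; have := I_gt ij2 Ij.
by rewrite ltNge ltW //; apply: (@I_lt i) => //; rewrite ltnSn (ltn_trans ij2).
Qed.

(** Elements sharing a point are neighbours, so a third one is impossible. Outside the range the
    values are dummies. *)
Lemma lo_hi_exist : exists lo hi : R -> nat, forall a, range f a ->
  [/\ I (lo a) a, I (hi a) a, forall j, I j a -> (lo a <= j <= hi a)%N &
      (hi a <= (lo a).+1)%N].
Proof.
have /choice[g gP] : forall a, exists p : nat * nat, range f a ->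
  [/\ I p.1 a, I p.2 a, forall j, I j a -> (p.1 <= j <= p.2)%N &
      (p.2 <= p.1.+1)%N].
  move=> a; have [Za|nZ] := pselect (range f a); last by exists (0%N, 0%N).
  have [j Ij] := range_I Za.
  have [[i [Ii ij]]|ne] := pselect (exists i, I i a /\ i <> j); last first.
    exists (j, j) => _; split=> //= i Ii; suff -> : i = j by rewrite leqnn.
    by apply: contrapT => ij; apply: ne; exists i.
  wlog lt : i j Ij Ii ij / (i < j)%N => [wl|].
    have [lt|lt|e] := ltngtP i j; first exact: (wl i j).
      by apply: (wl j i) => // e; rewrite e in ij.
    by [].
  have e := I_adj lt Ii Ij; exists (i, j) => _; rewrite /= e.
  split=> //; first by rewrite -e.
  move=> k Ik; apply/andP; split; rewrite leqNgt; apply/negP => h.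
    by have := I_adj (ltn_trans h lt) Ik Ij; rewrite e => -[ek]; rewrite ek ltnn in h.
  have := I_adj (ltn_trans (ltnSn i) h) Ii Ik => ek.
  by rewrite ek ltnn in h.
by exists (fun a => (g a).1), (fun a => (g a).2).
Qed.

Variables (lo hi : R -> nat).
Hypothesis lohi : forall a, range f a ->
  [/\ I (lo a) a, I (hi a) a, forall j, I j a -> (lo a <= j <= hi a)%N &
      (hi a <= (lo a).+1)%N].

Lemma I_lo a : range f a -> I (lo a) a. Proof. by move=> /lohi[]. Qed.
Lemma I_hi a : range f a -> I (hi a) a. Proof. by move=> /lohi[]. Qed.

Lemma I_lohi a j : I j a -> (lo a <= j <= hi a)%N.
Proof. by move=> Ij; have [_ _ + _] := lohi (I_range Ij); apply. Qed.

Lemma lohi_S a : range f a -> lo a <> hi a -> hi a = (lo a).+1.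
Proof.
move=> Za ne; have [Il _ /(_ _ Il)] := lohi Za; lia.
Qed.

Lemma hi_lt a j z : range f a -> (hi a < j)%N -> I j z -> a < z.
Proof.
move=> Za hj Iz; have jN := Iout Iz; rewrite ltNge; apply/negP => za.
have ac : a < c j by apply: (I_lt _ (I_hi Za)); rewrite hj.
have : I j a by apply: (I_itv Iz (Ic jN)); rewrite za ltW.
by move=> /I_lohi; lia.
Qed.

Lemma lo_gt a j z : range f a -> (j < lo a)%N -> I j z -> z < a.
Proof.
move=> Za hj Iz; have jN := Iout Iz; rewrite ltNge; apply/negP => za.
have ac : c j < a by exact: (I_gt hj (I_lo Za)).
have : I j a by apply: (I_itv (Ic jN) Iz); rewrite za ltW.
by move=> /I_lohi; lia.
Qed.

(** Consecutive critical values may enclose a gap of the range; the second clause keeps the pairs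
    with a nonempty slab between them. *)
Definition zone a b := consecutive crit a b /\ `[a, b] `<=` range f.

Lemma zone_ends a b : zone a b -> range f a /\ range f b.
Proof.
move=> [[_ _ /ltW ab _] sub]; split; apply: sub; rewrite /= in_itv /= ?lexx ?ab //.
Qed.

(** Otherwise one element would contain both critical values: if [lo b < hi a], then [a] lies
    between [c (lo b)] and [b], hence in [I (lo b)]. *)
Lemma zone_lohi a b : zone a b -> (hi a < lo b)%N.
Proof.
move=> zab; have [Za Zb] := zone_ends zab; have [[ac bc ab _] _] := zab.
rewrite ltnNge leq_eqVlt; apply/negP => /predU1P[e|lt].
  have Ia := I_hi Za; rewrite -e in Ia.
  by have e' := I_crit ac bc Ia (I_lo Zb); rewrite e' ltxx in ab.
have Ib := I_lo Zb; have ca := I_gt lt (I_hi Za).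
have Ia : I (lo b) a by apply: (I_itv (Ic (Iout Ib)) Ib); rewrite !ltW.
by have e' := I_crit ac bc Ia Ib; rewrite e' ltxx in ab.
Qed.

Lemma I_zone a b j : zone a b -> (hi a < j < lo b)%N -> I j `<=` oslab a%:E b%:E.
Proof.
move=> zab /andP[hj jl] z Iz; have [Za Zb] := zone_ends zab.
by rewrite /oslab /= !lte_fin (hi_lt Za hj) // (lo_gt Zb jl).
Qed.

(** In contrast to single elements, the index may be [hi a]: it is enough that [I j.+1] lies above
    [a] and [I j] below [b]. *)
Lemma II_zone a b j : zone a b -> (hi a <= j < lo b)%N ->
  I j `&` I j.+1 `<=` oslab a%:E b%:E.
Proof.
move=> zab /andP[hj jl] z [Iz Iz']; have [Za Zb] := zone_ends zab.
rewrite /oslab /= !lte_fin (lo_gt Zb jl) // andbT.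
by rewrite (hi_lt Za _ Iz').
Qed.

Lemma zone_oslab_crit a b d : zone a b -> d \in crit -> ~ oslab a%:E b%:E d.
Proof. by move=> [[_ _ _ /(_ d) n] _] /n; rewrite /oslab /= !lte_fin. Qed.

(** An element without critical values is located by its point [c j], which lies between two
    consecutive critical values; the order of the cover then bounds [j]. *)
Lemma I_zone_cases j : (j < N)%N ->
  (exists2 a, a \in crit & I j a) \/
  (exists a b, zone a b /\ (hi a < j < lo b)%N).
Proof.
move=> jN; have [|ne] := pselect (exists2 a, a \in crit & I j a); first by left.
have nc : c j \notin crit by apply/negP => cc; apply: ne; exists (c j) => //; exact: Ic.
have [a [b [cab /andP[ac cb] sub]]] :=
  consecutive_around fmorse hX bf (I_range (Ic jN)) nc.
right; exists a, b; have zab : zone a b by [].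
have [Za Zb] := zone_ends zab; have [[acr bcr _ _] _] := zab.
split=> //; apply/andP; split; rewrite ltnNge leq_eqVlt; apply/negP => /predU1P[e|lt].
- by apply: ne; exists a => //; rewrite e; exact: I_hi.
- by have := I_gt lt (I_hi Za); rewrite ltNge ltW.
- by apply: ne; exists b => //; rewrite -e; exact: I_lo.
- by have := @I_lt (lo b) j b; rewrite lt jN ltNge ltW // => /(_ erefl (I_lo Zb)).
Qed.

(** The overlap is located by any of its points [z]. If the index were out of bounds, convexity
    would put [a] or [b] itself into the overlap. *)
Lemma II_zone_cases j z : I j z -> I j.+1 z ->
  (exists2 a, a \in crit & I j a /\ I j.+1 a) \/
  (exists a b, zone a b /\ (hi a <= j < lo b)%N).
Proof.
move=> Iz Iz'.
have [|ne] := pselect (exists2 a, a \in crit & I j a /\ I j.+1 a); first by left.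
have nc : z \notin crit by apply/negP => cc; apply: ne; exists z.
have [a [b [cab /andP[az zb] sub]]] :=
  consecutive_around fmorse hX bf (I_range Iz) nc.
right; exists a, b; have zab : zone a b by [].
have [Za Zb] := zone_ends zab; have [[acr bcr _ _] _] := zab.
split=> //; apply/andP; split; rewrite leqNgt; apply/negP => lt.
- have ca := I_gt lt (I_hi Za).
  have Ia : I j a by apply: (I_itv (Ic (Iout Iz)) Iz); rewrite !ltW.
  have e := I_adj lt Ia (I_hi Za).
  by apply: ne; exists a => //; split=> //; rewrite -e; exact: I_hi.
- have cb : b < c j.+1 by apply: (@I_lt (lo b)); rewrite ?lt ?(Iout Iz') //; exact: I_lo.
  have Ib : I j.+1 b by apply: (I_itv Iz' (Ic (Iout Iz'))); rewrite !ltW.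
  have [e] := I_adj lt (I_lo Zb) Ib.
  by apply: ne; exists b => //; split=> //; rewrite e; exact: I_lo.
Qed.

(** The two elements are relatively open and cover the segment, so by connectedness they cannot be
    disjoint. *)
Lemma I_overlap j x y : I j x -> I j.+1 y -> `[x, y] `<=` range f ->
  exists z, I j z /\ I j.+1 z.
Proof.
move=> Ix Iy sub; have [yx|xy] := leP y x.
  (* Here [c j < y <= x], so [y] itself is in [I j]. *)
  exists y; split=> //; apply: (I_itv (Ic (Iout Ix)) Ix).
  by rewrite yx andbT; apply/ltW/(I_gt _ Iy).
have [ci _ _ _] := covgomic.
have [U [oU _ UE]] := ci _ (cov_I Ix); have [V [oV _ VE]] := ci _ (cov_I Iy).
apply: contrapT => disj.
(* A point of the segment in a third element lies between [x] and [c j] or between [c j.+1] and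
   [y]. *)
have xyI z : `[x, y]%classic z -> I j z \/ I j.+1 z.
  move=> xz; have [k Ik] := range_I (sub _ xz).
  move: xz; rewrite /= in_itv /= => /andP[xz zy].
  have [kj|jk|e] := ltngtP k j; last by left; rewrite -e.
    left; apply: (I_itv Ix (Ic (Iout Ix))); rewrite xz /=.
    by apply/ltW/(I_lt _ Ik); rewrite kj (Iout Ix).
  right; move: jk; rewrite leq_eqVlt => /predU1P[->//|jk].
  by apply: (I_itv (Ic (Iout Iy)) Iy); rewrite zy andbT; apply/ltW/(I_gt jk).
have UI z : `[x, y]%classic z -> U z -> I j z by move=> /sub Zz Uz; rewrite UE.
have VI z : `[x, y]%classic z -> V z -> I j.+1 z by move=> /sub Zz Uz; rewrite VE.
have IU z : I j z -> U z by rewrite {1}UE => -[].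
have IV z : I j.+1 z -> V z by rewrite {1}VE => -[].
have sx : `[x, y]%classic x by rewrite /= in_itv /= lexx ltW.
have sy : `[x, y]%classic y by rewrite /= in_itv /= lexx ltW.
suff e : `[x, y]%classic `&` U = `[x, y]%classic.
  have [_ Uy] : (`[x, y]%classic `&` U) y by rewrite e.
  by apply: disj; exists y; split=> //; exact: UI.
apply: (@segment_connected _ x y).
- by exists x; split=> //; exact: IU.
- by exists U.
- exists (~` V); first exact: open_closedC.
  apply/seteqP; split=> z [xz h]; split=> //.
    by move=> Vz; apply: disj; exists z; split; [exact: UI|exact: VI].
  by have [/IU//|/IV] := xyI z xz.
Qed.

(** Provides the level onto which [pi0_equiv_zone_overlap] retracts. One point in each element is
    enough, provided that the segment between them stays in [[a, b]]: the critical value for an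
    extreme index, the value of [c] otherwise. *)
Lemma II_zone_nonempty a b j : zone a b -> (hi a <= j < lo b)%N ->
  exists z, I j z /\ I j.+1 z.
Proof.
move=> zab /andP[hj jl]; have [Za Zb] := zone_ends zab.
have [[_ _ ab _] sub] := zab.
have bN := Iout (I_lo Zb).
have [x Ix ax] : exists2 x, I j x & a <= x.
  move: hj; rewrite leq_eqVlt => /predU1P[<-|hj]; first by exists a => //; exact: I_hi.
  have jN := ltn_trans jl bN.
  by exists (c j); [exact: Ic|exact/ltW/(hi_lt Za hj)/Ic].
have [y Iy yb] : exists2 y, I j.+1 y & y <= b.
  move: jl; rewrite leq_eqVlt => /predU1P[->|jl]; first by exists b => //; exact: I_lo.
  have jN := ltn_trans jl bN.
  by exists (c j.+1); [exact: Ic|exact/ltW/(lo_gt Zb jl)/Ic].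
apply: (I_overlap Ix Iy) => z; rewrite /= in_itv /= => /andP[xz zy].
by apply: sub; rewrite /= in_itv /= (le_trans ax) // (le_trans zy).
Qed.

(** * Path components over levels, elements, overlaps and slabs, and the ends of arcs *)

Lemma pi0_equiv_level j a : a \in crit -> I j a ->
  pi0_equiv R (f @^-1` [set a]) (f @^-1` I j).
Proof.
move=> ac Ia; apply: (@pi0_equiv_intervals _ _ a) => //; first exact: I_itv.
- exact: is_interval_level.
- by move=> x ->.
- by move=> d dc Id; exact: I_crit dc ac Id Ia.
Qed.

Lemma pi0_equiv_level_overlap j a : a \in crit -> I j a -> I j.+1 a ->
  pi0_equiv R (f @^-1` [set a]) (f @^-1` (I j `&` I j.+1)).
Proof.
move=> ac Ia Ia'; apply: (@pi0_equiv_intervals _ _ a) => //.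
- by apply: is_intervalI; exact: I_itv.
- exact: is_interval_level.
- by move=> x ->.
- by move=> d dc [Id _]; exact: I_crit dc ac Id Ia.
Qed.

Lemma pi0_equiv_zone a b j : zone a b -> (hi a < j < lo b)%N ->
  pi0_equiv R (f @^-1` I j) (f @^-1` oslab a%:E b%:E).
Proof.
move=> zab hl; have [_ Zb] := zone_ends zab.
have jN : (j < N)%N by have := Iout (I_lo Zb); lia.
apply: (@pi0_equiv_intervals _ _ (c j)).
- exact: is_interval_oslab.
- exact: I_itv.
- exact: I_zone.
- exact: Ic.
- by move=> d dc /(zone_oslab_crit zab dc).
Qed.

Lemma pi0_equiv_zone_overlap a b j : zone a b -> (hi a <= j < lo b)%N ->
  pi0_equiv R (f @^-1` (I j `&` I j.+1)) (f @^-1` oslab a%:E b%:E).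
Proof.
move=> zab hl; have [z [Iz Iz']] := II_zone_nonempty zab hl.
apply: (@pi0_equiv_intervals _ _ z) => //.
- exact: is_interval_oslab.
- by apply: is_intervalI; exact: I_itv.
- exact: II_zone.
- by move=> d dc /(zone_oslab_crit zab dc).
Qed.

Lemma I_inj i j : (j < N)%N -> I i = I j -> i = j.
Proof. by move=> jN e; apply: Icinj => //; rewrite e; exact: Ic. Qed.

Lemma I_pair_inj i j : (i.+1 < N)%N -> (j.+1 < N)%N ->
  [set I i; I i.+1] = [set I j; I j.+1] -> i = j.
Proof.
move=> iN jN.
have ne : I i <> I i.+1 by move=> /(I_inj iN); lia.
move=> /(set2_cases ne)[[h _]|[h h']]; first by apply: I_inj h; exact: ltnW.
have := I_inj jN h; have := I_inj (ltnW jN) h'; lia.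
Qed.

Lemma zone_eq a b a' b' t : zone a b -> zone a' b' ->
  oslab a%:E b%:E t -> oslab a'%:E b'%:E t -> a = a' /\ b = b'.
Proof.
move=> [[ac bc _ n] _] [[ac' bc' _ n'] _].
rewrite /oslab /= !lte_fin => /andP[at_ tb] /andP[at' tb'].
split; apply/eqP; rewrite eq_le !leNgt; apply/andP; split; apply/negP => h.
- by apply: (n' a ac); rewrite h (lt_trans at_).
- by apply: (n a' ac'); rewrite h (lt_trans at').
- by apply: (n b' bc'); rewrite h (lt_trans at_).
- by apply: (n' b bc); rewrite h (lt_trans at').
Qed.

Let cf : continuous f. Proof. by case: fmorse. Qed.

(** The flow line from [x] to the level [d] stays in the slab, hence in [e], until its end point,
    which lies in [u]. *)
Lemma attach_flow a b fl d (e u : set X) x : slab_flow f a%:E b%:E fl ->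
  d = a \/ d = b -> path_component R (f @^-1` oslab a%:E b%:E) e ->
  e x -> a < b -> u (fl x d) -> joined R (e `|` u) x (fl x d).
Proof.
move=> flP dab ce ex ab ux; have [fl0 _ cfl _ _] := flP.
have ox : oslab a%:E b%:E (f x) := pcomp_sub ce ex.
have dc : cslab a%:E b%:E d.
  by rewrite /cslab /= !lee_fin; case: dab => ->; rewrite lexx ltW.
rewrite -{1}(fl0 x ox); apply: (joined_curve (cfl x ox)) => v v01.
set s := f x + v * (d - f x).
have sc : cslab a%:E b%:E s.
  by apply: (convex_comb _ _ dc v01); [exact: is_interval_cslab|exact: oslab_cslab].
split=> //; have [sd|sd] := eqVneq s d; first by rewrite sd; right.
have so : oslab a%:E b%:E s.
  move: ox v01; rewrite /oslab /= !lte_fin => /andP[h1 h2] /andP[v0 v1].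
  have v1' : v < 1.
    by rewrite lt_neqAle v1 andbT; apply: contra_neq sd; rewrite /s => ->; lra.
  by case: dab => dE; move: sd; rewrite /s dE => sd; apply/andP; split; nra.
left; rewrite -/s; refine (pcomp_closed ce ex _).
apply: (joined_flow_to flP) => //; exact: is_interval_oslab.
Qed.

Definition attached (e u : set X) :=
  exists x y, [/\ e x, u y & joined R (e `|` u) x y].

Lemma attached_end a b d (e : set X) : zone a b -> d = a \/ d = b ->
  path_component R (f @^-1` oslab a%:E b%:E) e ->
  exists2 u, path_component R (f @^-1` [set d]) u & attached e u.
Proof.
move=> [cab _] dab ce; have [po _ _ _ _] := consecutive_slab fmorse cab.
have [fl flP] := slab_flow_exists cf hX po; have [_ ffl _ _ _] := flP.
have [_ _ ab _] := cab; have [x ex] := pcomp_nonempty ce.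
have dc : cslab a%:E b%:E d.
  by rewrite /cslab /= !lee_fin; case: dab => ->; rewrite lexx ltW.
have fd : (f @^-1` [set d]) (fl x d) by apply: ffl => //; exact: pcomp_sub ce _ ex.
have [u cu ux] := pcomp_of R fd; exists u => //; exists x, (fl x d); split=> //.
exact: attach_flow flP dab ce ex ab ux.
Qed.

(** Forwards, the path from [e] to [u] lies over the slab with its end [d] added, where [d] is the
    only critical value, so it can be shrunk to lie over [I l] as well. Backwards, a common point of
    [C] and [D] flows to the level [d] inside [D], and two points of that level in [D] are joined
    within the level. *)
Lemma attached_overlap a b d l (e u C D : set X) : zone a b -> d = a \/ d = b ->
  path_component R (f @^-1` oslab a%:E b%:E) e ->
  path_component R (f @^-1` [set d]) u ->
  I l d -> path_component R (f @^-1` I l) D -> overlap u D ->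
  C `<=` e -> C `<=` f @^-1` I l -> C !=set0 ->
  attached e u <-> overlap C D.
Proof.
move=> [cab _] dab ce cu Id cD [y [uy Dy]] Ce CI [x0 Cx0].
have [ac bc ab ncr] := cab; have [po _ _ _ _] := consecutive_slab fmorse cab.
have dcr : d \in crit by case: dab => ->.
have fy : f y = d := pcomp_sub cu uy.
have dc : cslab a%:E b%:E d.
  by rewrite /cslab /= !lee_fin; case: dab => ->; rewrite lexx ltW.
split.
- move=> [x1 [y1 [ex1 uy1 j]]]; exists x0; split=> //.
  pose K := oslab a%:E b%:E `|` [set d].
  have iK : is_interval K.
    move=> s t Ks Kt z /andP[sz zt].
    have [->|zd] := eqVneq z d; [by right|left].
    move: Ks Kt; rewrite /K /oslab /= !lte_fin => Ks Kt.
    by case: Ks => [/andP[? ?]|?]; case: Kt => [/andP[? ?]|?];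
      case: dab => dE; move: zd; rewrite dE; subst; move=> zd;
      apply/andP; split; rewrite ?lt_neqAle 1?eq_sym ?zd //=; lra.
  have euK : e `|` u `<=` f @^-1` K.
    by move=> z [/(pcomp_sub ce)|/(pcomp_sub cu)]; [left|right].
  have jK : joined R (f @^-1` K) x0 y.
    apply: joined_trans (_ : joined R (f @^-1` K) x0 x1) _.
      apply: joined_sub (pcomp_joined ce (Ce _ Cx0) ex1) => z; by left.
    apply: joined_trans (joined_sub euK j) _.
    by apply: joined_sub (pcomp_joined cu uy1 uy) => z; right.
  apply: (pcomp_closed cD Dy); apply: joined_sym.
  apply: (@joined_sub _ _ (f @^-1` (K `&` I l))); first by move=> z [].
  apply: (joined_shrink fmorse hX iK (t0 := d) _ _ _ _ _ _ jK).
  + by apply: is_intervalI => //; exact: I_itv.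
  + by move=> z [].
  + by split=> //; right.
  + move=> c0 c0c [|//]; rewrite /oslab /= !lte_fin => h.
    by case: (ncr _ c0c).
  + split; last exact: CI.
    by left; exact: pcomp_sub ce _ (Ce _ Cx0).
  + by rewrite /preimage /= fy; split=> //; right.
- move=> [x [Cx Dx]]; have [fl flP] := slab_flow_exists cf hX po.
  have [_ ffl _ _ _] := flP; have ex := Ce _ Cx.
  have ox : oslab a%:E b%:E (f x) := pcomp_sub ce ex.
  have Dx' : D (fl x d).
    apply: (pcomp_closed cD Dx).
    by apply: (joined_flow_to flP ox dc) => //; [exact: I_itv|exact: CI].
  have ux' : u (fl x d).
    have [_ h _] := pi0_equiv_level dcr Id.
    apply: (pcomp_closed cu uy); apply: h => //; first exact: ffl.
    exact: pcomp_joined cD Dy Dx'.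
  by exists x, (fl x d); split=> //; exact: attach_flow flP dab ce ex ab ux'.
Qed.

(** * Correspondence between the two graphs *)

Local Notation G := (reeb_multigraph f crit).

Variable lev : vert G -> R.
Hypothesis levP : forall u, lev u \in crit /\
  path_component R (f @^-1` [set lev u]) (sval u).

Definition split_set : set (vert G) := fun u => lo (lev u) <> hi (lev u).
Local Notation SG := (split_vertices split_set).

(** For an arc from [a] to [b] this counts the indices strictly between [hi a] and [lo b];
    [zone_lohi] makes the truncated difference exact. *)
Definition subdivisions (e : edge SG) : nat :=
  if e is inl e then (lo (sval e).1.2 - hi (sval e).1.1).-1 else 0%N.
Local Notation H := (subdivide subdivisions).
Local Notation M := (multinerve_mapper f cov).

(** The pieces of an edge are numbered from its lower end. Piece [i] crosses the overlap of the
    elements of index [first_index + i] and its successor; the new vertex between pieces [i] and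
    [i.+1] sits at that successor. *)
Definition first_index (e : edge SG) : nat :=
  match e with inl e => hi (sval e).1.1 | inr w => lo (lev (sval w)) end.
Definition edge_base (e : edge SG) : set X :=
  match e with inl e => (sval e).2 | inr w => sval (sval w) end.
Definition edge_zone (e : edge SG) : set R :=
  match e with
  | inl e => oslab (sval e).1.1%:E (sval e).1.2%:E
  | inr w => [set lev (sval w)]
  end.

(* Vertex p of the subdivision corresponds to a component over
   [I (vertex_index p)], and edge q to one over
   [I (edge_index q) `&` I (edge_index q).+1]. *)
Definition vertex_index (p : vert H) : nat :=
  match p with
  | inl w => if (sval w).2 then hi (lev (sval w).1) else lo (lev (sval w).1)
  | inr w => (first_index (sval w).1 + (sval w).2).+1
  end.
Definition vertex_base (p : vert H) : set X :=
  match p with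
  | inl w => sval (sval w).1
  | inr w => edge_base (sval w).1
  end.
Definition vertex_zone (p : vert H) : set R :=
  match p with
  | inl w => [set lev (sval w).1]
  | inr w => edge_zone (sval w).1
  end.
Definition edge_index (q : edge H) : nat := first_index (sval q).1 + (sval q).2.

Lemma lev_eq u x : sval u x -> lev u = f x.
Proof. by have [_ cu] := levP u => /(pcomp_sub cu). Qed.

Lemma lev_range u : range f (lev u).
Proof. by have [_ /pcomp_nonempty[x ux]] := levP u; rewrite (lev_eq ux); exists x. Qed.

Lemma lev_in (a : R) (C : set X) (u : vert G) :
  path_component R (f @^-1` [set a]) C -> sval u = C -> lev u = a.
Proof.
move=> cC uC; have [x Cx] := pcomp_nonempty cC.
by rewrite (@lev_eq u x) ?uC //; exact: pcomp_sub cC _ Cx.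
Qed.

Lemma edge_zoneP (e : edge G) : zone (sval e).1.1 (sval e).1.2.
Proof.
case: e => -[[a b] C] /= [cab cC]; split=> //.
have [x Cx] := pcomp_nonempty cC; have := pcomp_sub cC Cx.
by rewrite /oslab /preimage /= !lte_fin => /(segment_range fmorse hX cab); apply; exists x.
Qed.

Lemma edge_comp (e : edge G) : path_component R
  (f @^-1` oslab (sval e).1.1%:E (sval e).1.2%:E) (sval e).2.
Proof. by case: e => -[[a b] C] /= []. Qed.

Lemma edge_base_comp e : path_component R (f @^-1` edge_zone e) (edge_base e).
Proof. by case: e => [e|[u Su]] /=; [exact: edge_comp|have [] := levP u]. Qed.

Lemma vertex_base_comp p : path_component R (f @^-1` vertex_zone p) (vertex_base p).
Proof.
by case: p => [[[u b] ub]|[[e i] ie]] /=; [have [] := levP u|exact: edge_base_comp].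
Qed.

(** The last piece of an arc ends in the first element that contains the upper critical value. In
    this form later arithmetic avoids truncated subtraction. *)
Lemma subdivisionsE (e : edge G) :
  ((hi (sval e).1.1 + subdivisions (inl e)).+1 = lo (sval e).1.2)%N.
Proof. by have := zone_lohi (edge_zoneP e); rewrite /=; lia. Qed.

Lemma split_lohi u : split_set u -> hi (lev u) = (lo (lev u)).+1.
Proof. exact: lohi_S (lev_range u). Qed.

(** For an arc the overlap is contained in the slab; for the edge created by a split the critical
    level is contained in the overlap. *)
Lemma edge_linked (q : edge H) : pi0_linked R (f @^-1` edge_zone (sval q).1)
  (f @^-1` (I (edge_index q) `&` I (edge_index q).+1)).
Proof.
case: q => -[[e|[u Su]] i] /= qi; rewrite /edge_index /=.
  right; apply: pi0_equiv_zone_overlap (edge_zoneP e) _.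
  by have := subdivisionsE e; move: qi => /=; lia.
move: qi; rewrite leqn0 => /eqP->; rewrite addn0; left.
apply: pi0_equiv_level_overlap; first by have [] := levP u.
  exact: I_lo (lev_range u).
by rewrite -split_lohi //; exact: I_hi (lev_range u).
Qed.

Lemma vertex_linked (p : vert H) : pi0_linked R (f @^-1` vertex_zone p)
  (f @^-1` I (vertex_index p)).
Proof.
case: p => [[[u b] ub]|[[[e|u] i] //= ie]] /=; last first.
  right; apply: pi0_equiv_zone (edge_zoneP e) _.
  by have := subdivisionsE e; move: ie => /=; lia.
left; apply: pi0_equiv_level; first by have [] := levP u.
by case: b {ub}; [exact: I_hi (lev_range u)|exact: I_lo (lev_range u)].
Qed.

Lemma vertex_index_lt p : (vertex_index p < N)%N.
Proof.
have [D cD _] := linked_component (vertex_linked p) (vertex_base_comp p).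
by have [x /(pcomp_sub cD)/Iout] := pcomp_nonempty cD.
Qed.

Lemma edge_index_lt q : ((edge_index q).+1 < N)%N.
Proof.
have [D cD _] := linked_component (edge_linked q) (edge_base_comp (sval q).1).
by have [x /(pcomp_sub cD)[_ /Iout]] := pcomp_nonempty cD.
Qed.

(** Only a common point is asked for, since the component of the Mapper may contain the base
    component or be contained in it. *)
Definition vertex_rel (p : vert H) (m : vert M) :=
  (sval m).1 = I (vertex_index p) /\ overlap (vertex_base p) (sval m).2.

Definition edge_rel (q : edge H) (m : edge M) :=
  (sval m).1 = [set I (edge_index q); I (edge_index q).+1] /\
  overlap (edge_base (sval q).1) (sval m).2.

Lemma vertex_comp p m : vertex_rel p m ->
  path_component R (f @^-1` I (vertex_index p)) (sval m).2.
Proof. by case: m => -[J C] /= [cJ cC] [/= <- _]. Qed.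

Lemma edge_index_I q : I (edge_index q) <> I (edge_index q).+1.
Proof. by move=> /(I_inj (edge_index_lt q)); lia. Qed.

Lemma edge_rel_comp q m : edge_rel q m ->
  path_component R (f @^-1` (I (edge_index q) `&` I (edge_index q).+1)) (sval m).2.
Proof.
case: m => -[P C] /= [J [J' [_ _ ne PE cC]]] [/= PE' _]; move: cC.
rewrite PE in PE'; have [[-> ->]//|[-> ->]] := set2_cases ne PE'.
by rewrite setIC.
Qed.

Lemma vertex_rel_total p : exists m, vertex_rel p m.
Proof.
have [D cD BD] := linked_component (vertex_linked p) (vertex_base_comp p).
have cI : cov (I (vertex_index p)).
  by have [x /(pcomp_sub cD)/cov_I] := pcomp_nonempty cD.
by exists (exist _ (I (vertex_index p), D) (conj cI cD)).
Qed.

Lemma vertex_rel_fun p m m' : vertex_rel p m -> vertex_rel p m' -> m = m'.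
Proof.
move=> pm pm'; apply: sval_inj.
have e := linked_unique (vertex_linked p) (vertex_base_comp p) (vertex_comp pm)
  (vertex_comp pm') pm.2 pm'.2.
by move: e pm.1 pm'.1; case: (sval m) (sval m') => [? ?] [? ?] /= -> -> ->.
Qed.

Lemma edge_rel_total q : exists m, edge_rel q m.
Proof.
have [D cD BD] := linked_component (edge_linked q) (edge_base_comp (sval q).1).
have ex : exists J J', [/\ cov J, cov J', J <> J',
    ([set I (edge_index q); I (edge_index q).+1], D).1 = [set J; J'] &
    path_component R (f @^-1` (J `&` J')) D].
  have [x /(pcomp_sub cD)[Ix Ix']] := pcomp_nonempty cD.
  exists (I (edge_index q)), (I (edge_index q).+1).
  by split=> //; [exact: cov_I Ix|exact: cov_I Ix'|exact: edge_index_I].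
by exists (exist _ ([set I (edge_index q); I (edge_index q).+1], D) ex).
Qed.

Lemma edge_rel_fun q m m' : edge_rel q m -> edge_rel q m' -> m = m'.
Proof.
move=> qm qm'; apply: sval_inj.
have e := linked_unique (edge_linked q) (edge_base_comp (sval q).1)
  (edge_rel_comp qm) (edge_rel_comp qm') qm.2 qm'.2.
by move: e qm.1 qm'.1; case: (sval m) (sval m') => [? ?] [? ?] /= -> -> ->.
Qed.

Lemma level_vertex a (C : set X) : a \in crit ->
  path_component R (f @^-1` [set a]) C -> exists2 u : vert G, sval u = C & lev u = a.
Proof.
move=> ac cC; have uP : exists2 a, a \in crit & path_component R (f @^-1` [set a]) C.
  by exists a.
by exists (exist _ C uP) => //; exact: lev_in cC _.
Qed.

Lemma vertex_rel_surj m : exists p, vertex_rel p m.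
Proof.
case: m => -[J C] mP; have [/= /covE[j jN JE] cC] := mP; subst J.
have [[a ac Ia]|[a [b [zab hl]]]] := I_zone_cases jN.
  have [D cD DC] := linked_component (pi0_linked_sym (or_introl (pi0_equiv_level ac Ia))) cC.
  have [u uD ua] := level_vertex ac cD.
  (* [j] is [lo a] or [hi a]; the upper copy is needed only when the two differ, and then the node
     is split. *)
  have [w [wj wu]] : exists w : vert SG,
      vertex_index (inl w) = j /\ (sval w).1 = u.
    have [h1 h2] := andP (I_lohi Ia).
    have [je|jl] := eqVneq j (lo a).
      have wP : (u, false).2 -> split_set (u, false).1 by [].
      by exists (exist _ (u, false) wP); rewrite /= ua.
    have lh : lo a <> hi a by move=> e; move: jl; rewrite eqn_leq h1 e h2.
    have wP : (u, true).2 -> split_set (u, true).1 by rewrite /split_set /= ua.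
    exists (exist _ (u, true) wP); rewrite /= ua; split=> //.
    by have := lohi_S (I_range Ia) lh; lia.
  exists (inl w); split; first by rewrite wj.
  by rewrite /= wu uD; exact: overlap_sym.
have [D cD DC] := linked_component (or_introl (pi0_equiv_zone zab hl)) cC.
have eP : consecutive crit (a, b, D).1.1 (a, b, D).1.2 /\
    path_component R (f @^-1` oslab (a, b, D).1.1%:E (a, b, D).1.2%:E) (a, b, D).2.
  by case: zab.
pose e : edge G := exist _ (a, b, D) eP.
(* The predecessor compensates the successor in [vertex_index]. *)
have wP : ((inl e : edge SG, (j - hi a).-1).2 < subdivisions (inl e : edge SG, (j - hi a).-1).1)%N.
  by rewrite /=; lia.
exists (inr (exist _ (inl e : edge SG, (j - hi a).-1) wP)); split=> /=.
  by congr I; lia.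
exact: overlap_sym.
Qed.

Lemma vert_eq (u u' : vert G) (A C : set X) : lev u = lev u' ->
  pi0_linked R (f @^-1` [set lev u]) A -> path_component R A C ->
  overlap (sval u) C -> overlap (sval u') C -> u = u'.
Proof.
move=> uu' uA cC uC uC'; apply: sval_inj.
have [_ cu] := levP u; have [_ cu'] := levP u'; rewrite -uu' in cu'.
exact: linked_unique (pi0_linked_sym uA) cC cu cu' (overlap_sym uC) (overlap_sym uC').
Qed.

Lemma edge_eq (e e' : edge G) t (A C : set X) :
  oslab (sval e).1.1%:E (sval e).1.2%:E t ->
  oslab (sval e').1.1%:E (sval e').1.2%:E t ->
  pi0_linked R (f @^-1` oslab (sval e).1.1%:E (sval e).1.2%:E) A ->
  path_component R A C ->
  overlap (sval e).2 C -> overlap (sval e').2 C -> e = e'.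
Proof.
move=> et et' eA cC eC eC'; apply: sval_inj.
have [ea eb] := zone_eq (edge_zoneP e) (edge_zoneP e') et et'.
have ce' := edge_comp e'; rewrite -ea -eb in ce'.
have := linked_unique (pi0_linked_sym eA) cC (edge_comp e) ce'
  (overlap_sym eC) (overlap_sym eC').
by move: ea eb; case: (sval e) (sval e') => [[? ?] ?] [[? ?] ?] /= -> -> ->.
Qed.

Lemma split_vert_eq (w w' : vert SG) : (sval w).1 = (sval w').1 ->
  vertex_index (inl w) = vertex_index (inl w') -> w = w'.
Proof.
case: w w' => -[u b] wb [[u' b'] wb'] /= uu'; subst u'; move=> bb'.
apply: sval_inj => /=; congr pair.
case: b b' wb wb' bb' => -[] //= wb wb' h; first by case: (wb erefl).
by case: (wb' erefl).
Qed.

Lemma split_vert_level (w : vert SG) : I (vertex_index (inl w)) (lev (sval w).1).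
Proof.
by case: w => -[u []] /= _; [exact: I_hi (lev_range u)|exact: I_lo (lev_range u)].
Qed.

Lemma zone_index (e : edge G) i :
  (i < subdivisions (inl e))%N ->
  (hi (sval e).1.1 < (first_index (inl e) + i).+1 < lo (sval e).1.2)%N.
Proof. by have := subdivisionsE e; rewrite /=; lia. Qed.

Lemma zone_index2 (e : edge G) i :
  (i <= subdivisions (inl e))%N ->
  (hi (sval e).1.1 <= first_index (inl e) + i < lo (sval e).1.2)%N.
Proof. by have := subdivisionsE e; rewrite /=; lia. Qed.

Lemma split_edge_level (w : {v | split_set v}) :
  I (lo (lev (sval w))) (lev (sval w)) /\ I (lo (lev (sval w))).+1 (lev (sval w)).
Proof.
rewrite -(split_lohi (svalP w)); have Z := lev_range (sval w).
by split; [exact: I_lo|exact: I_hi].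
Qed.

Lemma II_zone_level (e : edge G) (u : vert G) j :
  (hi (sval e).1.1 <= j < lo (sval e).1.2)%N -> ~ (I j (lev u) /\ I j.+1 (lev u)).
Proof.
move=> hl /(II_zone (edge_zoneP e) hl); apply: zone_oslab_crit (edge_zoneP e) _.
by have [] := levP u.
Qed.

Lemma I_zone_level (e : edge G) (u : vert G) j :
  (hi (sval e).1.1 < j < lo (sval e).1.2)%N -> ~ I j (lev u).
Proof.
move=> hl /(I_zone (edge_zoneP e) hl); apply: zone_oslab_crit (edge_zoneP e) _.
by have [] := levP u.
Qed.

(** The element determines the index. A copy of a node and a subdivision vertex never share an
    index, since an element inside a zone contains no critical value. *)
Lemma vertex_rel_inj p p' m : vertex_rel p m -> vertex_rel p' m -> p = p'.
Proof.
move=> pm pm'; have cC := vertex_comp pm.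
have pp' : vertex_index p = vertex_index p'.
  by apply: I_inj (vertex_index_lt p') _; rewrite -pm.1 -pm'.1.
have lp := vertex_linked p; have jN := vertex_index_lt p.
case: p p' pm pm' cC pp' lp jN => [w|[[[e|//] i] wi]] [w'|[[[e'|//] i'] wi']].
- move=> [_ pm] [_ pm'] cC pp' lp _; congr inl; apply: split_vert_eq => //.
  have Iw := split_vert_level w; have Iw' := split_vert_level w'.
  apply: vert_eq lp cC pm pm'; rewrite -pp' in Iw'.
  have [uc _] := levP (sval w).1; have [uc' _] := levP (sval w').1.
  exact: I_crit uc uc' Iw Iw'.
- move=> _ _ _ pp' _ _; have := split_vert_level w; rewrite pp'.
  by move=> /(I_zone_level (zone_index wi')).
- move=> _ _ _ pp' _ _; have := split_vert_level w'; rewrite -pp'.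
  by move=> /(I_zone_level (zone_index wi)).
- move=> [_ pm] [_ pm'] cC pp' lp jN; congr inr; apply: sval_inj.
  (* The point [c] of the common index lies in both slabs, so the two arcs have the same zone. *)
  have It := I_zone (edge_zoneP e) (zone_index wi) (Ic jN).
  rewrite pp' in jN.
  have It' := I_zone (edge_zoneP e') (zone_index wi') (Ic jN).
  rewrite -[X in c X]pp' in It'.
  have ee' := edge_eq It It' lp cC pm pm'.
  by move: pp'; rewrite /= ee' => /eqP; rewrite eqSS eqn_add2l => /eqP->.
Qed.

Lemma edge_rel_inj q q' m : edge_rel q m -> edge_rel q' m -> q = q'.
Proof.
move=> qm qm'; have cC := edge_rel_comp qm.
have qq' : edge_index q = edge_index q'.
  by apply: I_pair_inj (edge_index_lt q) (edge_index_lt q') _; rewrite -qm.1 -qm'.1.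
have lq := edge_linked q; have [x Cx] := pcomp_nonempty cC.
have Ix := pcomp_sub cC Cx; have Ix' := Ix; rewrite qq' in Ix'.
case: q q' qm qm' cC qq' lq Ix Ix' => [[[e|w] i] wi] [[[e'|w'] i'] wi'].
- move=> [_ pm] [_ pm'] cC qq' lq Ix Ix'; apply: sval_inj.
  have ze := II_zone (edge_zoneP e) (zone_index2 wi) Ix.
  have ze' := II_zone (edge_zoneP e') (zone_index2 wi') Ix'.
  have ee' := edge_eq ze ze' lq cC pm pm'.
  by move: qq'; rewrite /edge_index /= ee' => /eqP; rewrite eqn_add2l => /eqP->.
- move=> _ _ _ qq' _ _ _; have i0 : i' = 0%N by move: (wi') => /=; rewrite leqn0 => /eqP.
  rewrite /edge_index /= i0 addn0 in qq'; have := split_edge_level w'; rewrite -qq'.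
  by move=> /(II_zone_level (zone_index2 wi)).
- move=> _ _ _ qq' _ _ _; have i0 : i = 0%N by move: (wi) => /=; rewrite leqn0 => /eqP.
  rewrite /edge_index /= i0 addn0 in qq'; have := split_edge_level w; rewrite qq'.
  by move=> /(II_zone_level (zone_index2 wi')).
- move=> [_ pm] [_ pm'] cC qq' lq _ _; apply: sval_inj.
  have i0 : i = 0%N by move: (wi) => /=; rewrite leqn0 => /eqP.
  have i0' : i' = 0%N by move: (wi') => /=; rewrite leqn0 => /eqP.
  have ll' := qq'; rewrite /edge_index /= i0 i0' !addn0 in ll'.
  have [Iw _] := split_edge_level w; have [Iw' _] := split_edge_level w'.
  have [uc _] := levP (sval w); have [uc' _] := levP (sval w').
  rewrite -ll' in Iw'.
  have := vert_eq (I_crit uc uc' Iw Iw') lq cC pm pm'.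
  by move=> /sval_inj ww'; rewrite /= i0 i0' ww'.
Qed.

Lemma edge_rel_surj m : exists q, edge_rel q m.
Proof.
case: m => -[P C] mP; have [J [J' [cJ cJ' JJ' /= PE cC]]] := mP.
(* Elements that meet are neighbours, so the unordered pair can be written with indices [j] and
   [j.+1]. *)
have [j [jN PE' {}cC]] : exists j, [/\ (j.+1 < N)%N, P = [set I j; I j.+1] &
    path_component R (f @^-1` (I j `&` I j.+1)) C].
  move: cJ cJ' => /covE[i iN Ji] /covE[i' iN' Ji']; subst J J'.
  have [x /(pcomp_sub cC)[Ix Ix']] := pcomp_nonempty cC.
  have [lt|lt|e] := ltngtP i i'; last by case: JJ'; rewrite e.
  - by have e := I_adj lt Ix Ix'; exists i; rewrite -e; split.
  - have e := I_adj lt Ix' Ix; exists i'; rewrite -e; split=> //.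
      by rewrite PE setUC.
    by rewrite setIC.
have [x /(pcomp_sub cC)[Ix Ix']] := pcomp_nonempty cC.
have [[a ac [Ia Ia']]|[a [b [zab hl]]]] := II_zone_cases Ix Ix'.
  have la : lo a = j /\ hi a = j.+1.
    have := I_lohi Ia; have := I_lohi Ia'.
    have [_ _ _] := lohi (I_range Ia); lia.
  have [D cD DC] :=
    linked_component (pi0_linked_sym (or_introl (pi0_equiv_level_overlap ac Ia Ia'))) cC.
  have [u uD ua] := level_vertex ac cD.
  have uS : split_set u by rewrite /split_set ua; case: la => -> ->; lia.
  pose e : edge SG := inr (exist _ u uS).
  have wP : ((e, 0%N).2 <= subdivisions (e, 0%N).1)%N by [].
  exists (exist _ (e, 0%N) wP); split; rewrite /edge_index /= ?addn0.
    by rewrite ua; case: la => -> _.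
  by rewrite uD; exact: overlap_sym.
have [D cD DC] := linked_component (or_introl (pi0_equiv_zone_overlap zab hl)) cC.
have eP : consecutive crit (a, b, D).1.1 (a, b, D).1.2 /\
    path_component R (f @^-1` oslab (a, b, D).1.1%:E (a, b, D).1.2%:E) (a, b, D).2.
  by case: zab.
pose e : edge SG := inl (exist _ (a, b, D) eP).
have wP : ((e, (j - hi a)%N).2 <= subdivisions (e, (j - hi a)%N).1)%N by rewrite /=; lia.
exists (exist _ (e, (j - hi a)%N) wP); split; rewrite /edge_index /=.
  by have -> : (hi a + (j - hi a) = j)%N by lia.
exact: overlap_sym.
Qed.

(** * Incidence in the two graphs *)

Lemma overlap_sub j l (C D : set X) : l = j \/ l = j.+1 ->
  path_component R (f @^-1` (I j `&` I j.+1)) C ->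
  path_component R (f @^-1` I l) D -> overlap C D -> C `<=` D.
Proof.
move=> lj cC cD [x [Cx Dx]] y Cy; apply: (pcomp_closed cD Dx).
apply: joined_sub (pcomp_joined cC Cx Cy) => z [].
by case: lj => ->.
Qed.

Lemma edge_ends (e : edge G) (u v : vert G) :
  ends e u v <-> [/\ lev u = (sval e).1.1, lev v = (sval e).1.2,
    attached (sval e).2 (sval u) & attached (sval e).2 (sval v)].
Proof.
have lv a (w : vert G) : sval w `<=` f @^-1` [set a] <-> lev w = a.
  split=> [h|<-]; last by have [_ /pcomp_sub] := levP w.
  have [_ /pcomp_nonempty[x wx]] := levP w.
  by rewrite (lev_eq wx); exact: h.
split=> [[/= /lv ? /lv ? ? ?]|[/lv ? /lv ? ? ?]]; split=> //.
Qed.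

(** [ends] speaks of both ends of an arc at once; this supplies the end about which nothing is
    given. *)
Lemma attached_vertex (e : edge G) d : d = (sval e).1.1 \/ d = (sval e).1.2 ->
  exists2 u, lev u = d & attached (sval e).2 (sval u).
Proof.
move=> dE; have [u cu eu] := attached_end (edge_zoneP e) dE (edge_comp e).
have dc : d \in crit by have [[? ? _ _] _] := edge_zoneP e; case: dE => ->.
by have [v vu vd] := level_vertex dc cu; exists v; rewrite ?vu.
Qed.

Lemma zone_sub_base (e : edge G) i (C : set X) : (i <= subdivisions (inl e))%N ->
  let j := (first_index (inl e) + i)%N in
  path_component R (f @^-1` (I j `&` I j.+1)) C -> overlap (sval e).2 C ->
  C `<=` (sval e).2.
Proof.
move=> ie j cC eC.
apply: (pi0_equiv_overlap _ cC (edge_comp e) (overlap_sym eC)).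
exact: pi0_equiv_zone_overlap (edge_zoneP e) (zone_index2 ie).
Qed.

Section ZoneEdge.
Variables (e : edge G) (i : nat) (C D : set X).
Hypothesis ie : (i <= subdivisions (inl e))%N.
Let j := (first_index (inl e) + i)%N.
Hypotheses (cC : path_component R (f @^-1` (I j `&` I j.+1)) C).
Hypothesis eC : overlap (sval e).2 C.

Let Ce : C `<=` (sval e).2. Proof. exact: zone_sub_base cC eC. Qed.

Let attachedE (d : R) (u : vert G) (l : nat) : l = j \/ l = j.+1 ->
  d = (sval e).1.1 \/ d = (sval e).1.2 -> lev u = d -> I l d ->
  path_component R (f @^-1` I l) D -> overlap (sval u) D ->
  attached (sval e).2 (sval u) <-> overlap C D.
Proof.
move=> lj dE ud Id cD uD.
apply: (attached_overlap (edge_zoneP e) dE (edge_comp e) _ Id cD uD) => //.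
- by rewrite -ud; have [] := levP u.
- by move=> x /(pcomp_sub cC) [] ? ?; case: lj => ->.
- by have [x] := pcomp_nonempty cC; exists x.
Qed.

(** Only piece [0] of an arc touches its lower node, and it does so in the upper copy if there is
    one: that copy has index [hi a], the first index of the arc. For [i > 0] the index belongs to an
    element without critical values. *)
Lemma lower_split_vertex (w : vert SG) :
  path_component R (f @^-1` I (vertex_index (inl w))) D ->
  overlap (sval (sval w).1) D ->
  sub_point (k := subdivisions) (inl e) i (inl w) <->
  vertex_index (inl w) = j /\ overlap C D.
Proof.
move=> cD wD; have hE := subdivisionsE e; have Iw := split_vert_level w.
split.
  move=> [v [[i0 [/edge_ends[wa _ ew _] wS _]]|[ik _]]]; last first.
    by move: ie; rewrite ik ltnn.
  have wj : vertex_index (inl w) = j.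
    rewrite /j i0 addn0 /= -wa; case: ((sval w).2) wS => //= wS.
    by apply: contrapT => ne; have := wS.2 ne.
  split=> //; rewrite wa in Iw.
  by apply/(attachedE _ _ wa Iw cD wD) => //; left.
move=> [wj CD].
have i0 : i = 0%N.
  apply/eqP; rewrite -leqn0 leqNgt; apply/negP => i_gt0.
  case: (I_zone_level (e := e) _ Iw).
  by rewrite wj /j; move: i_gt0 ie hE => /=; lia.
have Ia : I (vertex_index (inl w)) (sval e).1.1.
  rewrite wj /j i0 addn0 /=; apply: I_hi; exact: (zone_ends (edge_zoneP e)).1.
have wa : lev (sval w).1 = (sval e).1.1.
  have [uc _] := levP (sval w).1; have [[ac _ _ _] _] := edge_zoneP e.
  exact: I_crit uc ac Iw Ia.
(* [sub_point] also asks for the upper end of the arc, where arcs arrive at the lower copy of the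
   node. *)
have [v vb ev] := attached_vertex (e := e) (or_intror erefl).
have vP : (v, false).2 -> split_set (v, false).1 by [].
exists (exist _ (v, false) vP); left; split=> //; split=> //=.
  apply/edge_ends; split=> //.
  by apply/(attachedE _ _ wa Ia cD wD) => //; left.
split; first exact: (svalP w).
rewrite /split_set; move: wj; rewrite /j i0 addn0 /= -wa.
by case: ((sval w).2) => // ->.
Qed.

(** Mirror image: only the last piece reaches the upper node, in its lower copy of index [lo b]. *)
Lemma upper_split_vertex (w : vert SG) :
  path_component R (f @^-1` I (vertex_index (inl w))) D ->
  overlap (sval (sval w).1) D ->
  sub_point (k := subdivisions) (inl e) i.+1 (inl w) <->
  vertex_index (inl w) = j.+1 /\ overlap C D.
Proof.
move=> cD wD; have hE := subdivisionsE e; have Iw := split_vert_level w.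
split.
  move=> [v [[//]|[[ik] [/edge_ends[_ wb _ ew] _ wf]]]].
  have wj : vertex_index (inl w) = j.+1.
    by rewrite /j ik /= (negbTE wf) wb; move: hE => /=; lia.
  split=> //; rewrite wb in Iw.
  by apply/(attachedE _ _ wb Iw cD wD) => //; right.
move=> [wj CD].
have ik : i = subdivisions (inl e).
  apply/eqP; rewrite eqn_leq ie leqNgt; apply/negP => lt.
  case: (I_zone_level (e := e) _ Iw).
  by rewrite wj /j; move: lt hE => /=; lia.
have jb : j.+1 = lo (sval e).1.2 by rewrite /j ik; move: hE => /=; lia.
have Ib : I (vertex_index (inl w)) (sval e).1.2.
  by rewrite wj jb; apply: I_lo; exact: (zone_ends (edge_zoneP e)).2.
have wb : lev (sval w).1 = (sval e).1.2.
  have [uc _] := levP (sval w).1; have [[_ bc _ _] _] := edge_zoneP e.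
  exact: I_crit uc bc Iw Ib.
have [v va ev] := attached_vertex (e := e) (or_introl erefl).
(* Arcs leave their lower node from the upper copy exactly when that node is split. *)
have [v' [v'v v'S]] : exists v' : vert SG, (sval v').1 = v /\
    ((sval v').2 <-> split_set (sval v').1).
  have [vS|vS] := pselect (split_set v).
    have vP : (v, true).2 -> split_set (v, true).1 by [].
    by exists (exist _ (v, true) vP).
  have vP : (v, false).2 -> split_set (v, false).1 by [].
  by exists (exist _ (v, false) vP).
exists v'; right; split; first by rewrite ik.
split=> //.
  rewrite v'v; apply/edge_ends; split=> //.
  by apply/(attachedE _ _ wb Ib cD wD) => //; right.
apply/negP => wt; have := svalP w wt; apply.
by move: wj; rewrite /= wt jb -wb => ->.
Qed.

(** If the vertex is on [e], points of [C] and [D] lie over [I l] and are joined in the slab, hence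
    over [I l]. Conversely a common point of [C] and [D] lies in both arcs, which therefore
    coincide. *)
Lemma inner_vertex (w : {w : edge SG * nat | (w.2 < subdivisions w.1)%N}) l :
  l = j \/ l = j.+1 ->
  path_component R (f @^-1` I (vertex_index (inr w))) D ->
  overlap (edge_base (sval w).1) D ->
  ((sval w).1 = inl e /\ (first_index (inl e) + (sval w).2).+1 = l) <->
  (vertex_index (inr w) = l /\ overlap C D).
Proof.
case: w => -[[e'|//] i'] /= ie' lj cD wD; split.
  move=> [[ee'] il]; move: il; subst e' => il; split=> //.
  have [x Cx] := pcomp_nonempty cC; exists x; split=> //.
  have [y [ey Dy]] := wD; apply: (pcomp_closed cD Dy).
  have [_ h _] := pi0_equiv_zone (edge_zoneP e) (zone_index ie').
  apply: h; first exact: pcomp_sub cD _ Dy.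
    have [] := pcomp_sub cC Cx; rewrite /preimage /= il.
    by case: lj => ->.
  exact: pcomp_joined (edge_comp e) ey (Ce Cx).
move=> [wl [x [Cx Dx]]].
have De' : D `<=` (sval e').2.
  apply: (pi0_equiv_overlap _ cD (edge_comp e') (overlap_sym wD)).
  exact: pi0_equiv_zone (edge_zoneP e') (zone_index ie').
have ex := Ce Cx; have ex' := De' _ Dx.
have ox := pcomp_sub (edge_comp e) ex; have ox' := pcomp_sub (edge_comp e') ex'.
have ee' : e = e'.
  apply: (@edge_eq e e' (f x) _ (sval e).2 ox ox' _ (edge_comp e)).
  - by left; split=> // y By; exists y => //; exact: joined_refl.
  - by exists x.
  - by exists x.
by subst e'; split.
Qed.
End ZoneEdge.

Section SplitEdge.
Variables (s : {v | split_set v}) (C D : set X).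
Let j := lo (lev (sval s)).
Hypothesis cC : path_component R (f @^-1` (I j `&` I j.+1)) C.
Hypothesis sC : overlap (sval (sval s)) C.

Let sub_sC : sval (sval s) `<=` C.
Proof.
have [sc cs] := levP (sval s); have [Is Is'] := split_edge_level s.
exact: pi0_equiv_overlap (pi0_equiv_level_overlap sc Is Is') cs cC sC.
Qed.

(** The critical level lies in the overlap, so the base component of [s] is contained in [C]. If [D]
    meets [C] it contains [C], hence meets that base component; the index then selects the copy. *)
Lemma split_edge_vertex (w : vert SG) (b : bool) :
  path_component R (f @^-1` I (vertex_index (inl w))) D ->
  overlap (sval (sval w).1) D ->
  sval w = (sval s, b) <->
  vertex_index (inl w) = (if b then j.+1 else j) /\ overlap C D.
Proof.
move=> cD wD; have hS := split_lohi (svalP s).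
have [Is Is'] := split_edge_level s; have [sc cs] := levP (sval s).
split.
  move=> ws; rewrite /= ws /= hS; split; first by case: b {ws}.
  by rewrite ws in wD; have [x [sx Dx]] := wD; exists x; split=> //; exact: sub_sC.
move=> [wj CD]; have Iw := split_vert_level w; have [wc _] := levP (sval w).1.
have Isw : I (vertex_index (inl w)) (lev (sval s)) by rewrite wj; case: b {wj}.
have ls : lev (sval w).1 = lev (sval s) := I_crit wc sc Iw Isw.
have CsubD : C `<=` D.
  by apply: overlap_sub cC cD CD; rewrite wj; case: b {wj}; [right|left].
have ws : (sval w).1 = sval s.
  apply: (vert_eq ls _ cD wD).
    by rewrite ls; left; exact: pi0_equiv_level.
  by have [x sx] := pcomp_nonempty cs; exists x; split=> //; apply/CsubD/sub_sC.
move: wj; rewrite /= ws; case: (sval w) ws => u [] /= ->; rewrite ?hS -/j.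
  by case: b {Isw} => //; lia.
by case: b {Isw} => //; lia.
Qed.
End SplitEdge.

(** Translates incidence in the subdivided graph into Mapper data, namely an index and two
    components that meet; by [overlap_sub] meeting amounts to the inclusion required there. *)
Lemma sub_point_lower q m p n : edge_rel q m -> vertex_rel p n ->
  sub_point (sval q).1 (sval q).2 p <->
  vertex_index p = edge_index q /\ overlap (sval m).2 (sval n).2.
Proof.
move=> qm pn; have cC := edge_rel_comp qm; have cD := vertex_comp pn.
move: qm.2 pn.2 cC cD => {qm pn}; move: (sval m).2 (sval n).2 => C D.
case: q => -[[e|s] i] /= ie eC pD cC cD; rewrite /edge_index /= in cC *.
  case: p pD cD => [w|w] pD cD; first exact: lower_split_vertex.
  have := inner_vertex ie cC eC (or_introl erefl) cD pD.
  rewrite /= => h; rewrite -h; split=> -[-> h']; split=> //; lia.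
have i0 : i = 0%N by move: ie; rewrite leqn0 => /eqP.
subst i; rewrite addn0 in cC *.
case: p pD cD => [w|[[[e'|//] i'] ie']] pD cD.
  rewrite -(split_edge_vertex cC eC false cD pD).
  split=> [[v [[_ [ws _]]|[//]]]|ws]; first exact: ws.
  have vP : (sval s, true).2 -> split_set (sval s, true).1 by move=> _; exact: (svalP s).
  by exists (exist _ (sval s, true) vP); left; split.
split=> [[] //|[/= lE _]].
have [Is _] := split_edge_level s; rewrite -lE in Is.
by case: (I_zone_level (zone_index ie') Is).
Qed.

Lemma sub_point_upper q m p n : edge_rel q m -> vertex_rel p n ->
  sub_point (sval q).1 (sval q).2.+1 p <->
  vertex_index p = (edge_index q).+1 /\ overlap (sval m).2 (sval n).2.
Proof.
move=> qm pn; have cC := edge_rel_comp qm; have cD := vertex_comp pn.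
move: qm.2 pn.2 cC cD => {qm pn}; move: (sval m).2 (sval n).2 => C D.
case: q => -[[e|s] i] /= ie eC pD cC cD; rewrite /edge_index /= in cC *.
  case: p pD cD => [w|w] pD cD; first exact: upper_split_vertex.
  have := inner_vertex ie cC eC (or_intror erefl) cD pD.
  rewrite /= => h; rewrite -h; split=> -[-> h']; split=> //; lia.
have i0 : i = 0%N by move: ie; rewrite leqn0 => /eqP.
subst i; rewrite addn0 in cC *.
case: p pD cD => [w|[[[e'|//] i'] ie']] pD cD.
  rewrite -(split_edge_vertex cC eC true cD pD).
  split=> [[v [[//]|[_ [_ ws]]]]|ws]; first exact: ws.
  have vP : (sval s, false).2 -> split_set (sval s, false).1 by [].
  by exists (exist _ (sval s, false) vP); right; split.
split=> [[] //|[/= lE _]].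
have [_ Is] := split_edge_level s; rewrite -lE in Is.
by case: (I_zone_level (zone_index ie') Is).
Qed.

(** [ends] is symmetric in the Mapper but directed upwards in the subdivided Reeb graph, so the two
    graphs are compared through [incident]. *)
Lemma incident_iff q m p n p' n' :
  edge_rel q m -> vertex_rel p n -> vertex_rel p' n' ->
  incident q p p' <-> incident m n n'.
Proof.
move=> qm pn pn'.
have cC := edge_rel_comp qm; have cD := vertex_comp pn; have cD' := vertex_comp pn'.
have [x Cx] := pcomp_nonempty cC.
have ends_iff p1 n1 p2 n2 : vertex_rel p1 n1 -> vertex_rel p2 n2 ->
    ends q p1 p2 -> ends m n1 n2 /\ ends m n2 n1.
  move=> pn1 pn2 [/(sub_point_lower qm pn1)[e1 o1] /(sub_point_upper qm pn2)[e2 o2]].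
  have s1 := overlap_sub (or_introl e1) cC (vertex_comp pn1) o1.
  have s2 := overlap_sub (or_intror e2) cC (vertex_comp pn2) o2.
  rewrite /= pn1.1 pn2.1 qm.1 e1 e2; have ne := @edge_index_I q.
  by split; split=> //; [exact: nesym|rewrite setUC].
have ends_sub n1 n2 : ends m n1 n2 -> (sval m).2 `<=` (sval n1).2 /\
    (sval m).2 `<=` (sval n2).2 by case.
have mE : ends m n n' -> ends q p p' \/ ends q p' p.
  move=> [/= ne]; rewrite qm.1 pn.1 pn'.1 => mE s s'; rewrite pn.1 pn'.1 in ne.
  have o : overlap (sval m).2 (sval n).2 by exists x; split=> //; exact: s.
  have o' : overlap (sval m).2 (sval n').2 by exists x; split=> //; exact: s'.
  have qN := edge_index_lt q.
  have [[e e']|[e e']] := set2_cases ne (esym mE).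
    left; split.
      by apply/(sub_point_lower qm pn); split=> //; apply: I_inj e; exact: ltnW.
    by apply/(sub_point_upper qm pn'); split=> //; apply: I_inj e'.
  right; split.
    by apply/(sub_point_lower qm pn'); split=> //; apply: I_inj e'; exact: ltnW.
  by apply/(sub_point_upper qm pn); split=> //; apply: I_inj e.
split=> [[/(ends_iff _ _ _ _ pn pn')[]|/(ends_iff _ _ _ _ pn' pn)[]]|]; first by left.
  by left.
move=> [/mE//|[ne e s s']]; apply: mE; split=> //; first exact: nesym.
by rewrite setUC.
Qed.

Lemma graph_iso_indexed : graph_iso H M.
Proof.
have [phi bphi phiP] := correspondence_bij vertex_rel_total vertex_rel_surj
  vertex_rel_fun vertex_rel_inj.
have [psi bpsi psiP] := correspondence_bij edge_rel_total edge_rel_surj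
  edge_rel_fun edge_rel_inj.
exists phi, psi; split=> // q p p'.
exact: incident_iff (psiP q) (phiP p) (phiP p').
Qed.
End IndexedCover.

(** * The isomorphism and the final assembly *)

Lemma multinerve_iso (R : realType) (X : topologicalType) (f : X -> R)
    (crit : seq R) (cov : set (set R)) (eps : R) :
  morse_type f crit -> gomic (range f) cov -> (granularity cov <= eps%:E)%E ->
  hausdorff_space X -> bounded_set (range f) ->
  (forall a b, a \in crit -> b \in crit -> a <> b -> eps < `|a - b|) ->
  exists (S : set (vert (reeb_multigraph f crit)))
         (k : edge (split_vertices S) -> nat),
    graph_iso (subdivide k) (multinerve_mapper f cov).
Proof.
move=> fmorse covgomic coveps hX bf gap.
have [I [c [N [covE Ic Icinj cmono Iout]]]] :=
  cov_enum fmorse hX bf covgomic.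
have [lo [hi lohi]] := lo_hi_exist fmorse hX bf covgomic coveps gap covE Ic
  Icinj cmono Iout.
have /choice[lev levP] : forall u : vert (reeb_multigraph f crit), exists a,
    a \in crit /\ path_component R (f @^-1` [set a]) (sval u).
  by move=> [u [a ac cu]]; exists a.
exists (split_set lo hi lev), (subdivisions (lev := lev)).
exact: (graph_iso_indexed fmorse hX bf covgomic coveps gap covE Ic Icinj cmono
  Iout lohi levP).
Qed.

Unset Implicit Arguments.

Theorem corollary4p6 (R : realType) (X : topologicalType) (f : X -> R)
    (crit : seq R) (cov : set (set R)) (eps : R)
    (fmorse : morse_type f crit)
    (covgomic : gomic (range f) cov)
    (coveps : (granularity cov <= eps%:E)%E) :
  (forall D : dgm R, is_dgm (reeb_map f) D ->
    [/\ (seq_mset [seq p <- D | ~~ (pspan p <= eps)] `<=` signature cov D)%mset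
          /\ (signature cov D `<=` D)%mset,
        forall p, p \in (D `\` signature cov D)%mset -> pspan p <= eps,
        bottleneck (signature cov D) D <= eps / 2 &
        (forall p, p \in D -> eps < pspan p) -> signature cov D = D]) /\
  (hausdorff_space X -> bounded_set (range f) ->
   (forall a b, a \in crit -> b \in crit -> a <> b -> eps < `|a - b|) ->
   exists (S : set (vert (reeb_multigraph f crit)))
          (k : edge (split_vertices S) -> nat),
     graph_iso (subdivide k) (multinerve_mapper f cov)).
Proof.
split=> [D _|hX bf gap]; last exact: multinerve_iso fmorse covgomic coveps hX bf gap.
split.
- split; first exact: long_points_sub_signature coveps D.
  exact: signature_sub.
- exact: missing_point_span.
- exact: bottleneck_signature.
- exact: signature_id.
Qed.
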